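(* The assignment $X\mapsto\mathbb I\ltimes X$ defines a functor from the category of commutative $\mathbb I$-monoids to the category of permutative categories. The assignment $X\mapsto\mathbb P\ltimes X$ defines a functor from the category of commutative $\mathbb I$-monoids to the category of permutative categories, and a functor from the category of commutative $\mathbb I$-rigs to the category of bipermutative categories.
   Context: Categories: $\mathbb I$ is the category with objects $\mathbf n=\{1,\dots,n\}$, $n\ge0$ ($\mathbf 0=\emptyset$), and all injective maps. It is symmetric monoidal under concatenation $\mathbf m\sqcup\mathbf n=\{1,\dots,m+n\}$ with symmetry the $(m,n)$-shuffle $\tau_{\mathbf m,\mathbf n}$, and under the product $\mathbf m\times\mathbf n=\{1,\dots,mn\}$ (ordered pairs in lexicographic order, $\mathbf 0\times\mathbf n=\mathbf 0=\mathbf n\times\mathbf 0$) with symmetry the permutation $\tau^\times_{\mathbf m,\mathbf n}:(i,j)\mapsto(j,i)$. Left distributivity $\delta^l:\mathbf m\times\mathbf k\sqcup\mathbf n\times\mathbf k\to(\mathbf m\sqcup\mathbf n)\times\mathbf k$ is the identity, and right distributivity $\delta^r:\mathbf m\times\mathbf n\sqcup\mathbf m\times\mathbf k\to\mathbf m\times(\mathbf n\sqcup\mathbf k)$ is the evident permutation. $\mathbb P\subset\mathbb I$ is the subcategory of all objects and all bijections. Commutative $\mathbb I$-monoid: a functor $X:\mathbb I\to\mathrm{Top}$ with a natural transformation $\mu_{\mathbf m,\mathbf n}:X(\mathbf m)\times X(\mathbf n)\to X(\mathbf m\sqcup\mathbf n)$ of functors on $\mathbb I\times\mathbb I$ and a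 natural transformation $\eta_{\mathbf n}:*\to X(\mathbf n)$ from the constant functor at a point, satisfying associativity and unit axioms (for $*\in X(\mathbf 0)$) and commutativity $X(\tau_{\mathbf m,\mathbf n})(\mu_{\mathbf m,\mathbf n}(x,y))=\mu_{\mathbf n,\mathbf m}(y,x)$. Commutative $\mathbb I$-rig: a commutative $\mathbb I$-monoid $X$ with a natural transformation $\pi_{\mathbf m,\mathbf n}:X(\mathbf m)\times X(\mathbf n)\to X(\mathbf m\times\mathbf n)$ of functors on $\mathbb P\times\mathbb P$ (naturality on $\mathbb I\times\mathbb I$ is not required) and an element $1\in X(\mathbf 1)$. These satisfy associativity and unit axioms, left distributivity $\pi(\mu(x,y),z)=X(\delta^l)\,\mu(\pi(x,z),\pi(y,z))$, the analogous right distributivity with $\delta^r$, and commutativity $X(\tau^\times_{\mathbf m,\mathbf n})(\pi_{\mathbf m,\mathbf n}(x,y))=\pi_{\mathbf n,\mathbf m}(y,x)$. Morphisms: a map of commutative $\mathbb I$-monoids ($\mathbb I$-rigs) $X\to Y$ is a natural transformation $T$ of functors on $\mathbb I$ that commutes with $\mu$ (and $\pi$), i.e. $T\circ\mu_{\mathbf m,\mathbf n}=\mu_{\mathbf m,\mathbf n}\circ(T\times T)$ (and $T\circ\pi_{\mathbf m,\mathbf n}=\pi_{\mathbf m,\mathbf n}\circ(T\times T)$). Translation categories: for $\mathcal C=\mathbb I$ or $\mathbb P$, $\mathcal C\ltimes X$ is the topological category with objects $(\mathbf n,x)$, $x\in X(\mathbf n)$, and morphisms $(\mathbf n,x)\to(\mathbf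 m,y)$ the $\alpha:\mathbf n\to\mathbf m$ in $\mathcal C$ with $X(\alpha)(x)=y$. A morphism $T$ induces the functor of translation categories $(\mathbf n,x)\mapsto(\mathbf n,T(x))$. The permutative structure has $(\mathbf m,x)\oplus(\mathbf n,y)=(\mathbf m\sqcup\mathbf n,\mu_{\mathbf m,\mathbf n}(x,y))$, is given on morphisms by $\alpha\sqcup\beta$, and has strict unit $(\mathbf 0,* )$ and symmetry given by $\tau_{\mathbf m,\mathbf n}$. The second product on $\mathbb P\ltimes X$ for a commutative $\mathbb I$-rig is $(\mathbf m,x)\otimes(\mathbf n,y)=(\mathbf m\times\mathbf n,\pi_{\mathbf m,\mathbf n}(x,y))$, is given on morphisms by $\alpha\times\beta$, and has strict unit $(\mathbf 1,1)$. Bipermutative categories are in the sense of Elmendorf–Mandell (two permutative structures $\oplus,\otimes$ with natural left and right distributivity maps satisfying coherence axioms).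
   Formalization: Proved in two forms each: maps (and strict functors) either required to preserve units or not; and I-rigs either with the extra law π( *,x)=*=π(x,* ), giving all zero axioms of bipermutative categories, or without it, omitting those zero axioms. *)

(* Defs.v *)
From HB Require Import structures.
From mathcomp Require Import all_boot all_algebra.
From mathcomp Require Import boolp classical_sets functions topology.

Set Implicit Arguments.
Unset Strict Implicit.
Unset Printing Implicit Defensive.

Local Open Scope classical_set_scope.

Record category := Category {
  obj :> Type;
  cathom : obj -> obj -> Type;
  idc : forall a, cathom a a;
  compc : forall a b c, cathom b c -> cathom a b -> cathom a c;
  compc1l : forall a b (f : cathom a b), compc (idc b) f = f;
  compc1r : forall a b (f : cathom a b), compc f (idc a) = f;
  compcA : forall a b c d (h : cathom c d) (g : cathom b c) (f : cathom a b),
    compc h (compc g f) = compc (compc h g) f }.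

Definition functor_laws (C D : category) (F0 : C -> D)
    (F1 : forall a b : C, cathom a b -> cathom (F0 a) (F0 b)) : Prop :=
  (forall a : C, F1 a a (idc a) = idc (F0 a)) /\
  (forall (a b c : C) (g : cathom b c) (f : cathom a b),
     F1 a c (compc g f) = compc (F1 b c g) (F1 a b f)).

(* Morphisms m -> n of the category I of injections. The object n is 'I_n, so *)
(* {1, ..., n} is shifted to {0, ..., n-1}.                                   *)
Definition Ihom (m n : nat) := {f : {ffun 'I_m -> 'I_n} | injectiveb f}.

Definition Ifun m n (a : Ihom m n) : 'I_m -> 'I_n := sval a.
Coercion Ifun : Ihom >-> Funclass.

Lemma Ifun_inj m n (a : Ihom m n) : injective a.
Proof. exact/injectiveP/(svalP a). Qed.

Lemma ffun_injectiveb m n (f : 'I_m -> 'I_n) :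
  injective f -> injectiveb (finfun f).
Proof. by move=> fI; apply/injectiveP => i j; rewrite !ffunE; apply: fI. Qed.

Definition Imk m n (f : 'I_m -> 'I_n) (fI : injective f) : Ihom m n :=
  exist _ (finfun f) (ffun_injectiveb fI).

Lemma ImkE m n (f : 'I_m -> 'I_n) (fI : injective f) : Imk fI =1 f.
Proof. by move=> i; rewrite /Ifun /= ffunE. Qed.

Definition Iid n : Ihom n n := Imk (@inj_id 'I_n).

Definition Icomp m n k (b : Ihom n k) (a : Ihom m n) : Ihom m k :=
  Imk (inj_comp (@Ifun_inj _ _ b) (@Ifun_inj _ _ a)).

Definition Icast m n (e : m = n) : Ihom m n := Imk (@cast_ord_inj m n e).

Definition sum_fun m n m' n' (a : 'I_m -> 'I_m') (b : 'I_n -> 'I_n')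
    (k : 'I_(m + n)) : 'I_(m' + n') :=
  match fintype.split k with
  | inl i => lshift n' (a i)
  | inr j => rshift m' (b j)
  end.

Lemma sum_fun_inj m n m' n' (a : Ihom m m') (b : Ihom n n') :
  injective (sum_fun a b).
Proof.
move=> k l; rewrite /sum_fun -{2}(splitK k) -{2}(splitK l).
case: (fintype.split k) => i; case: (fintype.split l) => j /= E.
- by rewrite (Ifun_inj (lshift_inj E)).
- by move/eqP: E; rewrite eq_lrshift.
- by move/eqP: E; rewrite eq_rlshift.
- by rewrite (Ifun_inj (rshift_inj E)).
Qed.

Definition Isum m n m' n' (a : Ihom m m') (b : Ihom n n') :
  Ihom (m + n) (m' + n') := Imk (@sum_fun_inj _ _ _ _ a b).

Definition tau_fun m n (k : 'I_(m + n)) : 'I_(n + m) :=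
  match fintype.split k with
  | inl i => rshift n i
  | inr j => lshift m j
  end.

Lemma tau_fun_inj m n : injective (@tau_fun m n).
Proof.
move=> k l; rewrite /tau_fun -{2}(splitK k) -{2}(splitK l).
case: (fintype.split k) => i; case: (fintype.split l) => j /= E.
- by rewrite (rshift_inj E).
- by move/eqP: E; rewrite eq_rlshift.
- by move/eqP: E; rewrite eq_lrshift.
- by rewrite (lshift_inj E).
Qed.

Definition Itau m n : Ihom (m + n) (n + m) := Imk (@tau_fun_inj m n).

(* The element (i, j) of the product, in lexicographic order, is i * n + j.   *)
Lemma lex_subproof m n (i : 'I_m) (j : 'I_n) : (i * n + j < m * n)%N.
Proof.
apply: (@leq_trans (i.+1 * n)); last by rewrite leq_mul2r ltn_ord orbT.
by rewrite mulSn addnC ltn_add2r.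
Qed.

Definition lex m n (i : 'I_m) (j : 'I_n) : 'I_(m * n) :=
  Ordinal (lex_subproof i j).

Lemma lex1_subproof m n (k : 'I_(m * n)) : (k %/ n < m)%N.
Proof.
case: n k => [|n] k; last by rewrite ltn_divLR.
by case: k => k /=; rewrite muln0.
Qed.

Lemma lex2_subproof m n (k : 'I_(m * n)) : (k %% n < n)%N.
Proof.
case: n k => [|n] k; last by rewrite ltn_mod.
by case: k => k /=; rewrite muln0.
Qed.

Definition lex1 m n (k : 'I_(m * n)) : 'I_m := Ordinal (lex1_subproof k).
Definition lex2 m n (k : 'I_(m * n)) : 'I_n := Ordinal (lex2_subproof k).

Lemma lexK m n (k : 'I_(m * n)) : lex (lex1 k) (lex2 k) = k.
Proof. by apply: val_inj; rewrite /= -divn_eq. Qed.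

Lemma lex1K m n (i : 'I_m) (j : 'I_n) : lex1 (lex i j) = i.
Proof.
apply: val_inj => /=; have n0 : (0 < n)%N by case: n j => [[]|].
by rewrite divnMDl // divn_small ?addn0.
Qed.

Lemma lex2K m n (i : 'I_m) (j : 'I_n) : lex2 (lex i j) = j.
Proof. by apply: val_inj => /=; rewrite modnMDl modn_small. Qed.

Lemma lex_inj m n (i i' : 'I_m) (j j' : 'I_n) :
  lex i j = lex i' j' -> i = i' /\ j = j'.
Proof.
by move=> E; split; [rewrite -(lex1K i j) E lex1K|rewrite -(lex2K i j) E lex2K].
Qed.

Definition prod_fun m n m' n' (a : 'I_m -> 'I_m') (b : 'I_n -> 'I_n')
  (k : 'I_(m * n)) : 'I_(m' * n') := lex (a (lex1 k)) (b (lex2 k)).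

Lemma prod_fun_inj m n m' n' (a : Ihom m m') (b : Ihom n n') :
  injective (prod_fun a b).
Proof.
move=> k l /lex_inj[/Ifun_inj E1 /Ifun_inj E2].
by rewrite -(lexK k) -(lexK l) E1 E2.
Qed.

Definition Iprod m n m' n' (a : Ihom m m') (b : Ihom n n') :
  Ihom (m * n) (m' * n') := Imk (@prod_fun_inj _ _ _ _ a b).

Definition taux_fun m n (k : 'I_(m * n)) : 'I_(n * m) := lex (lex2 k) (lex1 k).

Lemma taux_fun_inj m n : injective (@taux_fun m n).
Proof. by move=> k l /lex_inj[E1 E2]; rewrite -(lexK k) -(lexK l) E1 E2. Qed.

Definition Itaux m n : Ihom (m * n) (n * m) := Imk (@taux_fun_inj m n).

Definition Ideltal m n k : Ihom (m * k + n * k) ((m + n) * k) :=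
  Icast (esym (mulnDl m n k)).

Definition deltar_fun m n k (l : 'I_(m * n + m * k)) : 'I_(m * (n + k)) :=
  match fintype.split l with
  | inl p => lex (lex1 p) (lshift k (lex2 p))
  | inr q => lex (lex1 q) (rshift n (lex2 q))
  end.

Lemma deltar_fun_inj m n k : injective (@deltar_fun m n k).
Proof.
move=> p q; rewrite /deltar_fun -{2}(splitK p) -{2}(splitK q).
case: (fintype.split p) => i; case: (fintype.split q) => j /lex_inj[E1 E2].
- by rewrite -(lexK i) -(lexK j) E1 (lshift_inj E2).
- by move/eqP: E2; rewrite eq_lrshift.
- by move/eqP: E2; rewrite eq_rlshift.
- by rewrite -(lexK i) -(lexK j) E1 (rshift_inj E2).
Qed.

Definition Ideltar m n k : Ihom (m * n + m * k) (m * (n + k)) :=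
  Imk (@deltar_fun_inj m n k).

(* Surjectivity: for an injection this is bijectivity.                        *)
Definition Ibij m n (a : Ihom m n) : bool := [forall j, j \in codom a].

(* Since (k + m) + n and k + (m + n) are different expressions for the same   *)
(* object of I, equations between elements of X at such objects are stated in *)
(* the total space {n & X n}; as nat is a set, this is equality up to the     *)
(* evident identification.                                                    *)
Record Ispace := {
  Isp :> nat -> topologicalType;
  Imap : forall m n, Ihom m n -> Isp m -> Isp n;
  Imap_continuous : forall m n (a : Ihom m n), continuous (Imap a);
  Imap_id : forall n (x : Isp n), Imap (Iid n) x = x;
  Imap_comp : forall m n k (b : Ihom n k) (a : Ihom m n) (x : Isp m),
    Imap (Icomp b a) x = Imap b (Imap a x) }.
Arguments Imap : clear implicits.
Arguments Imap X {m n} a x : rename.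

Definition el (X : Ispace) n (x : X n) : {n : nat & X n} :=
  existT (fun n => X n) n x.
Arguments el : clear implicits.
Arguments el X {n} x.

Record cIMonoid := {
  cIM_space :> Ispace;
  mu : forall m n, cIM_space m -> cIM_space n -> cIM_space (m + n)%N;
  mu_continuous : forall m n, continuous
    (fun p : cIM_space m * cIM_space n => mu p.1 p.2);
  mu_natural : forall m n m' n' (a : Ihom m m') (b : Ihom n n') x y,
    Imap cIM_space (Isum a b) (mu x y) =
    mu (Imap cIM_space a x) (Imap cIM_space b y);
  eta : forall n, cIM_space n;
  eta_natural : forall m n (a : Ihom m n),
    Imap cIM_space a (eta m) = eta n;
  muA : forall m n k (x : cIM_space m) (y : cIM_space n) (z : cIM_space k),
    el cIM_space (mu (mu x y) z) = el cIM_space (mu x (mu y z));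
  mu1l : forall n (x : cIM_space n),
    el cIM_space (mu (eta 0) x) = el cIM_space x;
  mu1r : forall n (x : cIM_space n),
    el cIM_space (mu x (eta 0)) = el cIM_space x;
  muC : forall m n (x : cIM_space m) (y : cIM_space n),
    Imap cIM_space (Itau m n) (mu x y) = mu y x }.
Arguments mu : clear implicits.
Arguments mu X {m n} x y : rename.

(* The law rpi(*, x) = * = rpi(x, *) is not a consequence of the other axioms *)
(* (take X constant at nat, mu = rpi = maxn, * = 1 = 0), and it holds exactly *)
(* when 0 is a strict zero object of the translation category. The flag z     *)
(* tells whether rigs (resp. bipermutative categories) are required to have   *)
(* an absorbing (resp. null) additive unit.                                   *)
Record cIRig (z : bool) := {
  cIR_monoid :> cIMonoid;
  rpi : forall m n, cIR_monoid m -> cIR_monoid n -> cIR_monoid (m * n)%N;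
  pi_continuous : forall m n, continuous
    (fun p : cIR_monoid m * cIR_monoid n => rpi p.1 p.2);
  pi_natural : forall m n m' n' (a : Ihom m m') (b : Ihom n n') x y,
    Ibij a -> Ibij b ->
    Imap cIR_monoid (Iprod a b) (rpi x y) =
    rpi (Imap cIR_monoid a x) (Imap cIR_monoid b y);
  rone : cIR_monoid 1%N;
  piA : forall m n k (x : cIR_monoid m) (y : cIR_monoid n) (w : cIR_monoid k),
    el cIR_monoid (rpi (rpi x y) w) = el cIR_monoid (rpi x (rpi y w));
  pi1l : forall n (x : cIR_monoid n),
    el cIR_monoid (rpi rone x) = el cIR_monoid x;
  pi1r : forall n (x : cIR_monoid n),
    el cIR_monoid (rpi x rone) = el cIR_monoid x;
  piDl : forall m n k (x : cIR_monoid m) (y : cIR_monoid n) (w : cIR_monoid k),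
    rpi (mu cIR_monoid x y) w =
    Imap cIR_monoid (Ideltal m n k) (mu cIR_monoid (rpi x w) (rpi y w));
  piDr : forall m n k (x : cIR_monoid m) (y : cIR_monoid n) (w : cIR_monoid k),
    rpi x (mu cIR_monoid y w) =
    Imap cIR_monoid (Ideltar m n k) (mu cIR_monoid (rpi x y) (rpi x w));
  piC : forall m n (x : cIR_monoid m) (y : cIR_monoid n),
    Imap cIR_monoid (Itaux m n) (rpi x y) = rpi y x;
  pi0l : z -> forall n (x : cIR_monoid n),
    el cIR_monoid (rpi (eta cIR_monoid 0) x) = el cIR_monoid (eta cIR_monoid 0);
  pi0r : z -> forall n (x : cIR_monoid n),
    el cIR_monoid (rpi x (eta cIR_monoid 0)) = el cIR_monoid (eta cIR_monoid 0) }.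
Arguments rpi : clear implicits.
Arguments rpi {z} X {m n} x y : rename.
Arguments rone : clear implicits.
Arguments rone {z} X : rename.

(* A natural transformation commuting with mu need not preserve units (take X *)
(* and Y constant and T constant at an idempotent of Y). The flag u tells     *)
(* whether morphisms are required to preserve units, on both the side of      *)
(* I-monoids and I-rigs and the side of (bi)permutative categories.           *)
Record is_mon_map (u : bool) (X Y : cIMonoid) (T : forall n, X n -> Y n)
    : Prop := {
  mm_continuous : forall n, continuous (T n);
  mm_natural : forall m n (a : Ihom m n) x,
    T n (Imap X a x) = Imap Y a (T m x);
  mm_mu : forall m n (x : X m) (y : X n),
    T (m + n)%N (mu X x y) = mu Y (T m x) (T n y);
  mm_eta : u -> forall n, T n (eta X n) = eta Y n }.

Record is_rig_map (u z : bool) (X Y : cIRig z) (T : forall n, X n -> Y n)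
    : Prop := {
  rm_mon : is_mon_map u T;
  rm_pi : forall m n (x : X m) (y : X n),
    T (m * n)%N (rpi X x y) = rpi Y (T m x) (T n y);
  rm_one : u -> T 1%N (rone X) = rone Y }.

Definition mon_hom (u : bool) (X Y : cIMonoid) :=
  {T : forall n, X n -> Y n | is_mon_map u T}.

Definition rig_hom (u z : bool) (X Y : cIRig z) :=
  {T : forall n, X n -> Y n | is_rig_map u T}.

Lemma is_mon_map_id u (X : cIMonoid) :
  is_mon_map u (fun n => id : X n -> X n).
Proof. by split => // n x; exact: cvg_id. Qed.

Lemma is_mon_map_comp u (X Y Z : cIMonoid) (S : forall n, Y n -> Z n)
    (T : forall n, X n -> Y n) :
  is_mon_map u S -> is_mon_map u T -> is_mon_map u (fun n => S n \o T n).
Proof.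
move=> [Sc Sn Sm Se] [Tc Tn Tm Te]; split => /=.
- by move=> n x; apply: continuous_comp; [exact: Tc|exact: Sc].
- by move=> m n a x; rewrite Tn Sn.
- by move=> m n x y; rewrite Tm Sm.
- by move=> u1 n; rewrite Te // Se.
Qed.

Lemma is_rig_map_id u z (X : cIRig z) :
  is_rig_map u (fun n => id : X n -> X n).
Proof. by split => //; exact: is_mon_map_id. Qed.

Lemma is_rig_map_comp u z (X Y Z : cIRig z) (S : forall n, Y n -> Z n)
    (T : forall n, X n -> Y n) :
  is_rig_map u S -> is_rig_map u T -> is_rig_map u (fun n => S n \o T n).
Proof.
move=> [Sm Sp S1] [Tm Tp T1]; split; first exact: is_mon_map_comp.
- by move=> m n x y; rewrite /= Tp Sp.
- by move=> u1; rewrite /= T1 // S1.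
Qed.

Definition mon_idc u X : mon_hom u X X := exist _ _ (is_mon_map_id u X).
Definition mon_compc u X Y Z (S : mon_hom u Y Z) (T : mon_hom u X Y) :
  mon_hom u X Z := exist _ _ (is_mon_map_comp (svalP S) (svalP T)).
Definition rig_idc u z (X : cIRig z) : rig_hom u X X :=
  exist _ _ (is_rig_map_id u X).
Definition rig_compc u z (X Y Z : cIRig z) (S : rig_hom u Y Z)
  (T : rig_hom u X Y) : rig_hom u X Z :=
  exist _ _ (is_rig_map_comp (svalP S) (svalP T)).

Definition cIMonoidCat (u : bool) : category.
Proof.
refine (@Category cIMonoid (@mon_hom u) (@mon_idc u) (@mon_compc u) _ _ _).
- by move=> X Y [T HT]; exact: eq_exist.
- by move=> X Y [T HT]; exact: eq_exist.
- by move=> X Y Z W [R HR] [S HS] [T HT]; exact: eq_exist.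
Defined.

Definition cIRigCat (u z : bool) : category.
Proof.
refine (@Category (cIRig z) (@rig_hom u z) (@rig_idc u z) (@rig_compc u z)
  _ _ _).
- by move=> X Y [T HT]; exact: eq_exist.
- by move=> X Y [T HT]; exact: eq_exist.
- by move=> X Y Z W [R HR] [S HS] [T HT]; exact: eq_exist.
Defined.

(* A topological category is a category internal to topological spaces:       *)
(* a space of objects, a space of all morphisms, and continuous structure     *)
(* maps, composition being defined on the pullback composable C.              *)
Record tcat_data := {
  Ob : topologicalType;
  Mor : topologicalType;
  src : Mor -> Ob;
  tgt : Mor -> Ob;
  idm : Ob -> Mor;
  tcomp : [set p : Mor * Mor | src p.1 = tgt p.2] -> Mor }.

Definition composable (C : tcat_data) : set (Mor C * Mor C) :=
  [set p | src p.1 = tgt p.2].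
Arguments composable : clear implicits.

(* composite g f h : the pair (g, f) is composable and g o f = h              *)
Definition composite (C : tcat_data) (g f h : Mor C) : Prop :=
  exists gf : (g, f) \in composable C, tcomp (exist _ (g, f) gf) = h.

(* commsq g f g' f' : both composites are defined and g o f = g' o f'         *)
Definition commsq (C : tcat_data) (g f g' f' : Mor C) : Prop :=
  exists h, composite g f h /\ composite g' f' h.

Record is_topcat (C : tcat_data) : Prop := {
  src_continuous : continuous (@src C);
  tgt_continuous : continuous (@tgt C);
  idm_continuous : continuous (@idm C);
  comp_continuous : continuous (@tcomp C);
  src_idm : forall a : Ob C, src (idm a) = a;
  tgt_idm : forall a : Ob C, tgt (idm a) = a;
  src_comp : forall g f h : Mor C, composite g f h -> src h = src f;
  tgt_comp : forall g f h : Mor C, composite g f h -> tgt h = tgt g;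
  comp_idl : forall f : Mor C, composite (idm (tgt f)) f f;
  comp_idr : forall f : Mor C, composite f (idm (src f)) f;
  comp_assoc : forall f g h gf hg : Mor C,
    composite g f gf -> composite h g hg -> commsq h gf hg f }.

Record mon_data (C : tcat_data) := {
  op0 : Ob C -> Ob C -> Ob C;
  op1 : Mor C -> Mor C -> Mor C;
  unit0 : Ob C;
  sym : Ob C -> Ob C -> Mor C }.

Record is_permutative (C : tcat_data) (M : mon_data C) : Prop := {
  op0_continuous : continuous (fun p : Ob C * Ob C => op0 M p.1 p.2);
  op1_continuous : continuous (fun p : Mor C * Mor C => op1 M p.1 p.2);
  sym_continuous : continuous (fun p : Ob C * Ob C => sym M p.1 p.2);
  op1_src : forall f g, src (op1 M f g) = op0 M (src f) (src g);
  op1_tgt : forall f g, tgt (op1 M f g) = op0 M (tgt f) (tgt g);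
  op1_id : forall a b, op1 M (idm a) (idm b) = idm (op0 M a b);
  op1_comp : forall f f' h g g' k : Mor C,
    composite f' f h -> composite g' g k ->
    composite (op1 M f' g') (op1 M f g) (op1 M h k);
  op0A : forall a b c, op0 M (op0 M a b) c = op0 M a (op0 M b c);
  op1A : forall f g h, op1 M (op1 M f g) h = op1 M f (op1 M g h);
  op0_unitl : forall a, op0 M (unit0 M) a = a;
  op0_unitr : forall a, op0 M a (unit0 M) = a;
  op1_unitl : forall f, op1 M (idm (unit0 M)) f = f;
  op1_unitr : forall f, op1 M f (idm (unit0 M)) = f;
  sym_src : forall a b, src (sym M a b) = op0 M a b;
  sym_tgt : forall a b, tgt (sym M a b) = op0 M b a;
  sym_natural : forall f g : Mor C,
    commsq (sym M (tgt f) (tgt g)) (op1 M f g)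
           (op1 M g f) (sym M (src f) (src g));
  sym_involutive : forall a b,
    composite (sym M b a) (sym M a b) (idm (op0 M a b));
  sym_unit : forall a, sym M a (unit0 M) = idm a;
  sym_hexagon : forall a b c,
    composite (op1 M (sym M a c) (idm b)) (op1 M (idm a) (sym M b c))
              (sym M (op0 M a b) c) }.

Record perm_data := {
  pcat :> tcat_data;
  padd : mon_data pcat }.

Definition is_permcat (C : perm_data) : Prop :=
  is_topcat C /\ is_permutative (padd C).

Record bip_data := {
  bcat :> tcat_data;
  badd : mon_data bcat;
  bmul : mon_data bcat;
  dl : Ob bcat -> Ob bcat -> Ob bcat -> Mor bcat;
  dr : Ob bcat -> Ob bcat -> Ob bcat -> Mor bcat }.

(* A bipermutative category in the sense of Elmendorf and Mandell: the        *)
(* distributivity maps dl and dr are natural but not required to be           *)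
(* invertible. The fields of is_null and dl_unit, dr_unit express that the    *)
(* product is bilinear in the pointed sense and strictly unital as a bilinear *)
(* map; dl_dr_mul is their diagram for ring categories, which in the presence *)
(* of dl_dr_gmul follows from the other ones.                                 *)
Section bipermutative.
Variable C : bip_data.
Local Notation "a ⊕ b" := (op0 (badd C) a b) (at level 50, left associativity).
Local Notation "a ⊗ b" := (op0 (bmul C) a b) (at level 40, left associativity).
Local Notation "f ⊞ g" := (op1 (badd C) f g) (at level 50, left associativity).
Local Notation "f ⊠ g" := (op1 (bmul C) f g) (at level 40, left associativity).
Local Notation zero := (unit0 (badd C)).
Local Notation one := (unit0 (bmul C)).
Local Notation gadd := (sym (badd C)).
Local Notation gmul := (sym (bmul C)).

Record is_null : Prop := {
  null_obl : forall a : Ob C, zero ⊗ a = zero;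
  null_obr : forall a : Ob C, a ⊗ zero = zero;
  null_morl : forall f : Mor C, idm zero ⊠ f = idm zero;
  null_morr : forall f : Mor C, f ⊠ idm zero = idm zero;
  null_gmul : forall a, gmul a zero = idm zero;
  null_dl1 : forall a b : Ob C, dl zero a b = idm (a ⊗ b);
  null_dl2 : forall a b : Ob C, dl a zero b = idm (a ⊗ b);
  null_dl3 : forall a b : Ob C, dl a b zero = idm zero;
  null_dr1 : forall a b : Ob C, dr zero a b = idm zero;
  null_dr2 : forall a b : Ob C, dr a zero b = idm (a ⊗ b);
  null_dr3 : forall a b : Ob C, dr a b zero = idm (a ⊗ b) }.

Record is_bipermcat (z : bool) : Prop := {
  bp_topcat : is_topcat C;
  bp_add : is_permutative (badd C);
  bp_mul : is_permutative (bmul C);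
  dl_continuous : continuous
    (fun p : Ob C * Ob C * Ob C => dl p.1.1 p.1.2 p.2);
  dr_continuous : continuous
    (fun p : Ob C * Ob C * Ob C => dr p.1.1 p.1.2 p.2);
  dl_src : forall a a' b : Ob C, src (dl a a' b) = (a ⊗ b) ⊕ (a' ⊗ b);
  dl_tgt : forall a a' b : Ob C, tgt (dl a a' b) = (a ⊕ a') ⊗ b;
  dr_src : forall a b b' : Ob C, src (dr a b b') = (a ⊗ b) ⊕ (a ⊗ b');
  dr_tgt : forall a b b' : Ob C, tgt (dr a b b') = a ⊗ (b ⊕ b');
  dl_natural : forall f f' g : Mor C,
    commsq (dl (tgt f) (tgt f') (tgt g)) ((f ⊠ g) ⊞ (f' ⊠ g))
           ((f ⊞ f') ⊠ g) (dl (src f) (src f') (src g));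
  dr_natural : forall f g g' : Mor C,
    commsq (dr (tgt f) (tgt g) (tgt g')) ((f ⊠ g) ⊞ (f ⊠ g'))
           (f ⊠ (g ⊞ g')) (dr (src f) (src g) (src g'));
  dl_unit : forall a a' : Ob C, dl a a' one = idm (a ⊕ a');
  dr_unit : forall b b' : Ob C, dr one b b' = idm (b ⊕ b');
  dl_add : forall a a' a'' b : Ob C,
    commsq (dl (a ⊕ a') a'' b) (dl a a' b ⊞ idm (a'' ⊗ b))
           (dl a (a' ⊕ a'') b) (idm (a ⊗ b) ⊞ dl a' a'' b);
  dr_add : forall a b b' b'' : Ob C,
    commsq (dr a (b ⊕ b') b'') (dr a b b' ⊞ idm (a ⊗ b''))
           (dr a b (b' ⊕ b'')) (idm (a ⊗ b) ⊞ dr a b' b'');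
  dl_gadd : forall a a' b : Ob C,
    commsq (gadd a a' ⊠ idm b) (dl a a' b)
           (dl a' a b) (gadd (a ⊗ b) (a' ⊗ b));
  dr_gadd : forall a b b' : Ob C,
    commsq (idm a ⊠ gadd b b') (dr a b b')
           (dr a b' b) (gadd (a ⊗ b) (a ⊗ b'));
  dl_mul : forall a a' b c : Ob C,
    composite (dl a a' b ⊠ idm c) (dl (a ⊗ b) (a' ⊗ b) c)
              (dl a a' (b ⊗ c));
  dr_mul : forall a b c c' : Ob C,
    composite (idm a ⊠ dr b c c') (dr a (b ⊗ c) (b ⊗ c'))
              (dr (a ⊗ b) c c');
  dl_dr_mul : forall a b b' c : Ob C,
    commsq (idm a ⊠ dl b b' c) (dr a (b ⊗ c) (b' ⊗ c))
           (dr a b b' ⊠ idm c) (dl (a ⊗ b) (a ⊗ b') c);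
  dl_dr_add : forall a a' b b' : Ob C, exists h,
    composite (dr a b b' ⊞ dr a' b b')
      (idm (a ⊗ b) ⊞ gadd (a' ⊗ b) (a ⊗ b') ⊞ idm (a' ⊗ b')) h /\
    commsq (dr (a ⊕ a') b b') (dl a a' b ⊞ dl a a' b')
           (dl a a' (b ⊕ b')) h;
  dl_dr_gmul : forall a a' b : Ob C,
    commsq (gmul (a ⊕ a') b) (dl a a' b)
           (dr b a a') (gmul a b ⊞ gmul a' b);
  bp_null : z -> is_null }.

End bipermutative.

Record tfun (C D : tcat_data) := TFun {
  f0 : Ob C -> Ob D;
  f1 : Mor C -> Mor D }.

Record is_tfun (C D : tcat_data) (F : tfun C D) : Prop := {
  f0_continuous : continuous (f0 F);
  f1_continuous : continuous (f1 F);
  f1_src : forall f, src (f1 F f) = f0 F (src f);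
  f1_tgt : forall f, tgt (f1 F f) = f0 F (tgt f);
  f1_id : forall a, f1 F (idm a) = idm (f0 F a);
  f1_comp : forall g f h,
    composite g f h -> composite (f1 F g) (f1 F f) (f1 F h) }.

Record is_strict (u : bool) (C D : tcat_data) (M : mon_data C)
    (N : mon_data D) (F : tfun C D) : Prop := {
  st_op0 : forall a b, f0 F (op0 M a b) = op0 N (f0 F a) (f0 F b);
  st_op1 : forall f g, f1 F (op1 M f g) = op1 N (f1 F f) (f1 F g);
  st_sym : forall a b, f1 F (sym M a b) = sym N (f0 F a) (f0 F b);
  st_unit : u -> f0 F (unit0 M) = unit0 N }.

Definition is_perm_map (u : bool) (C D : perm_data) (F : tfun C D) : Prop :=
  is_tfun F /\ is_strict u (padd C) (padd D) F.

Record is_bip_map (u : bool) (C D : bip_data) (F : tfun C D) : Prop := {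
  bm_tfun : is_tfun F;
  bm_add : is_strict u (badd C) (badd D) F;
  bm_mul : is_strict u (bmul C) (bmul D) F;
  bm_dl : forall a a' b, f1 F (dl a a' b) = dl (f0 F a) (f0 F a') (f0 F b);
  bm_dr : forall a b b', f1 F (dr a b b') = dr (f0 F a) (f0 F b) (f0 F b') }.

Definition tfun_id (C : tcat_data) : tfun C C := TFun id id.
Definition tfun_comp (C D E : tcat_data) (G : tfun D E) (F : tfun C D) :
  tfun C E := TFun (f0 G \o f0 F) (f1 G \o f1 F).

Lemma is_tfun_id (C : tcat_data) : is_tfun (tfun_id C).
Proof. by split => // x; exact: cvg_id. Qed.

Lemma is_tfun_comp (C D E : tcat_data) (G : tfun D E) (F : tfun C D) :
  is_tfun G -> is_tfun F -> is_tfun (tfun_comp G F).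
Proof.
move=> [Gc0 Gc1 Gs Gt Gi Gc] [Fc0 Fc1 Fs Ft Fi Fc]; split => /=.
- by move=> x; apply: continuous_comp; [exact: Fc0|exact: Gc0].
- by move=> x; apply: continuous_comp; [exact: Fc1|exact: Gc1].
- by move=> f; rewrite Gs Fs.
- by move=> f; rewrite Gt Ft.
- by move=> a; rewrite Fi Gi.
- by move=> g f h /Fc/Gc.
Qed.

Lemma is_strict_id u (C : tcat_data) (M : mon_data C) :
  is_strict u M M (tfun_id C).
Proof. by []. Qed.

Lemma is_strict_comp u (C D E : tcat_data) (M : mon_data C) (N : mon_data D)
    (P : mon_data E) (G : tfun D E) (F : tfun C D) :
  is_strict u N P G -> is_strict u M N F -> is_strict u M P (tfun_comp G F).
Proof.
move=> [G0 G1 Gs Gu] [F0 F1 Fs Fu]; split => /=.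
- by move=> a b; rewrite F0 G0.
- by move=> f g; rewrite F1 G1.
- by move=> a b; rewrite Fs Gs.
- by move=> u1; rewrite Fu // Gu.
Qed.

Lemma is_perm_map_id u C : is_perm_map u (tfun_id (pcat C)).
Proof. by split; [exact: is_tfun_id|exact: is_strict_id]. Qed.

Lemma is_perm_map_comp u (C D E : perm_data) (G : tfun D E) (F : tfun C D) :
  is_perm_map u G -> is_perm_map u F -> is_perm_map u (tfun_comp G F).
Proof.
by move=> [Gt Gs] [Ft Fs]; split;
  [exact: is_tfun_comp|exact: is_strict_comp Gs Fs].
Qed.

Lemma is_bip_map_id u C : is_bip_map u (tfun_id (bcat C)).
Proof. by split => //; exact: is_tfun_id. Qed.

Lemma is_bip_map_comp u (C D E : bip_data) (G : tfun D E) (F : tfun C D) :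
  is_bip_map u G -> is_bip_map u F -> is_bip_map u (tfun_comp G F).
Proof.
move=> [Gt Ga Gm Gl Gr] [Ft Fa Fm Fl Fr]; split => /=.
- exact: is_tfun_comp.
- exact: is_strict_comp Ga Fa.
- exact: is_strict_comp Gm Fm.
- by move=> a a' b; rewrite Fl Gl.
- by move=> a a' b; rewrite Fr Gr.
Qed.

Definition permcat := {C : perm_data | is_permcat C}.
Definition bipermcat (z : bool) := {C : bip_data | is_bipermcat C z}.

Definition perm_hom (u : bool) (C D : permcat) :=
  {F : tfun (sval C) (sval D) | is_perm_map u F}.
Definition bip_hom (u z : bool) (C D : bipermcat z) :=
  {F : tfun (sval C) (sval D) | is_bip_map u F}.

Definition perm_idc u (C : permcat) : perm_hom u C C :=
  exist _ _ (is_perm_map_id u (sval C)).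
Definition perm_compc u (C D E : permcat) (G : perm_hom u D E)
  (F : perm_hom u C D) : perm_hom u C E :=
  exist _ _ (is_perm_map_comp (svalP G) (svalP F)).
Definition bip_idc u z (C : bipermcat z) : bip_hom u C C :=
  exist _ _ (is_bip_map_id u (sval C)).
Definition bip_compc u z (C D E : bipermcat z) (G : bip_hom u D E)
  (F : bip_hom u C D) : bip_hom u C E :=
  exist _ _ (is_bip_map_comp (svalP G) (svalP F)).

Definition PermCat (u : bool) : category.
Proof.
refine (@Category permcat (@perm_hom u) (@perm_idc u) (@perm_compc u) _ _ _).
- by move=> C D [[F0 F1] HF]; exact: eq_exist.
- by move=> C D [[F0 F1] HF]; exact: eq_exist.
- by move=> B C D E [H HH] [G HG] [F HF]; exact: eq_exist.
Defined.

Definition BipermCat (u z : bool) : category.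
Proof.
refine (@Category (bipermcat z) (@bip_hom u z) (@bip_idc u z)
  (@bip_compc u z) _ _ _).
- by move=> C D [[F0 F1] HF]; exact: eq_exist.
- by move=> C D [[F0 F1] HF]; exact: eq_exist.
- by move=> B C D E [H HH] [G HG] [F HF]; exact: eq_exist.
Defined.

(* CI stands for I itself, CP for the subcategory P of bijections.            *)
Variant subI := CI | CP.

Definition inC (C : subI) m n (a : Ihom m n) : bool :=
  match C with CI => true | CP => Ibij a end.

Lemma Ibij_inC C m n (a : Ihom m n) : Ibij a -> inC C a.
Proof. by case: C. Qed.

Lemma IbijE m n (a : Ihom m n) : m = n -> Ibij a.
Proof.
move=> e; apply/forallP => j; apply: inj_card_onto; first exact: Ifun_inj.
by rewrite !card_ord e.
Qed.

Lemma Ibij_eq m n (a : Ihom m n) : Ibij a -> m = n.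
Proof.
move=> /forallP ab; rewrite -(card_ord m) -(card_ord n).
rewrite -(card_codom (@Ifun_inj _ _ a)); apply: eq_card => j.
by rewrite ab.
Qed.

Lemma inC_id C n : inC C (Iid n).
Proof. exact/Ibij_inC/IbijE. Qed.

Lemma inC_comp C m n k (b : Ihom n k) (a : Ihom m n) :
  inC C b -> inC C a -> inC C (Icomp b a).
Proof. by case: C => // /Ibij_eq eb /Ibij_eq ea; apply: IbijE; rewrite ea. Qed.

Lemma inC_sum C m n m' n' (a : Ihom m m') (b : Ihom n n') :
  inC C a -> inC C b -> inC C (Isum a b).
Proof. by case: C => // /Ibij_eq em /Ibij_eq en; apply: IbijE; rewrite em en. Qed.

Lemma inC_prod C m n m' n' (a : Ihom m m') (b : Ihom n n') :
  inC C a -> inC C b -> inC C (Iprod a b).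
Proof. by case: C => // /Ibij_eq em /Ibij_eq en; apply: IbijE; rewrite em en. Qed.

Lemma inC_tau C m n : inC C (Itau m n).
Proof. by apply: Ibij_inC; apply: IbijE; rewrite addnC. Qed.

Lemma inC_taux C m n : inC C (Itaux m n).
Proof. by apply: Ibij_inC; apply: IbijE; rewrite mulnC. Qed.

Lemma inC_deltal C m n k : inC C (Ideltal m n k).
Proof. by apply: Ibij_inC; apply: IbijE; rewrite mulnDl. Qed.

Lemma inC_deltar C m n k : inC C (Ideltar m n k).
Proof. by apply: Ibij_inC; apply: IbijE; rewrite mulnDr. Qed.

Record arrow (C : subI) := Arrow {
  dom : nat;
  cod : nat;
  arrI : Ihom dom cod;
  arrP : inC C arrI }.

Section arrow_choice.
Variable C : subI.

Definition arrow_sig : Type :=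
  {mn : nat * nat & {a : Ihom mn.1 mn.2 | inC C a}}.
Definition arrow_enc (a : arrow C) : arrow_sig :=
  existT (fun mn : nat * nat => {a : Ihom mn.1 mn.2 | inC C a})
    (dom a, cod a) (exist _ (arrI a) (arrP a)).
Definition arrow_dec (a : arrow_sig) : arrow C := Arrow (proj2_sig (projT2 a)).
Lemma arrow_encK : cancel arrow_enc arrow_dec. Proof. by case. Qed.

End arrow_choice.

HB.instance Definition _ C :=
  Choice.copy (arrow C) (can_type (@arrow_encK C)).

Section translation.
Variable C : subI.

Section space.
Variable X : Ispace.

(* A morphism (n, x) -> (m, y) is determined by its arrow n -> m and by x, so *)
(* the space of morphisms is the coproduct of copies of X n over all arrows.  *)
Definition tr_Ob : topologicalType := {n : nat & X n}.
Definition tr_Mor : topologicalType := {a : arrow C & X (dom a)}.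

Definition trm m n (a : Ihom m n) (aC : inC C a) (x : X m) : tr_Mor :=
  existT (fun a : arrow C => X (dom a)) (Arrow aC) x.

Definition tr_src (f : tr_Mor) : tr_Ob := el X (tagged f).
Definition tr_tgt (f : tr_Mor) : tr_Ob := el X (Imap X (arrI (tag f)) (tagged f)).
Definition tr_idm (a : tr_Ob) : tr_Mor := trm (inC_id C (tag a)) (tagged a).

Lemma tr_comp_cod (p : [set p : tr_Mor * tr_Mor | tr_src p.1 = tr_tgt p.2]) :
  cod (tag (set_val p).2) = dom (tag (set_val p).1).
Proof. by case: p => -[g f] /= /set_mem /= /(congr1 (@tag _ _)). Qed.

(* Icast is the identity map, from cod f to the equal number dom g.           *)
Definition tr_comp (p : [set p : tr_Mor * tr_Mor | tr_src p.1 = tr_tgt p.2])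
    : tr_Mor :=
  let g := (set_val p).1 in
  let f := (set_val p).2 in
  trm (inC_comp (arrP (tag g))
        (inC_comp (Ibij_inC C (IbijE (Icast (tr_comp_cod p)) (tr_comp_cod p)))
                  (arrP (tag f))))
      (tagged f).

Definition tr_cat : tcat_data :=
  @Build_tcat_data tr_Ob tr_Mor tr_src tr_tgt tr_idm tr_comp.

End space.

Definition tr_add (X : cIMonoid) : mon_data (tr_cat X) :=
  @Build_mon_data (tr_cat X)
    (fun a b : tr_Ob X => el X (mu X (tagged a) (tagged b)))
    (fun f g : tr_Mor X => trm (inC_sum (arrP (tag f)) (arrP (tag g)))
                               (mu X (tagged f) (tagged g)))
    (el X (eta X 0))
    (fun a b : tr_Ob X => trm (inC_tau C (tag a) (tag b))
                              (mu X (tagged a) (tagged b))).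

Definition translation (X : cIMonoid) : perm_data :=
  Build_perm_data (tr_add X).

Definition tr_map (X Y : Ispace) (T : forall n, X n -> Y n) :
    tfun (tr_cat X) (tr_cat Y) :=
  @TFun (tr_cat X) (tr_cat Y)
    (fun a : tr_Ob X => el Y (T _ (tagged a)))
    (fun f : tr_Mor X => trm (arrP (tag f)) (T _ (tagged f))).

End translation.

Definition tr_mul (z : bool) (X : cIRig z) : mon_data (tr_cat CP X) :=
  @Build_mon_data (tr_cat CP X)
    (fun a b : tr_Ob X => el X (rpi X (tagged a) (tagged b)))
    (fun f g : tr_Mor CP X => trm (inC_prod (arrP (tag f)) (arrP (tag g)))
                                  (rpi X (tagged f) (tagged g)))
    (el X (rone X))
    (fun a b : tr_Ob X => trm (inC_taux CP (tag a) (tag b))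
                              (rpi X (tagged a) (tagged b))).

Definition bitranslation (z : bool) (X : cIRig z) : bip_data :=
  @Build_bip_data (tr_cat CP X) (tr_add CP X) (tr_mul X)
    (fun a a' b : tr_Ob X =>
       trm (inC_deltal CP (tag a) (tag a') (tag b))
           (mu X (rpi X (tagged a) (tagged b)) (rpi X (tagged a') (tagged b))))
    (fun a b b' : tr_Ob X =>
       trm (inC_deltar CP (tag a) (tag b) (tag b'))
           (mu X (rpi X (tagged a) (tagged b)) (rpi X (tagged a) (tagged b')))).

(* Main.v *)
From mathcomp Require Import all_boot ring.
From mathcomp Require Import boolp classical_sets functions topology.
Require Import Defs.

(* An arrow of a translation category is determined by its source, its        *)
(* codomain in I and its underlying function between initial segments of nat. *)
(* Hence every axiom splits into an equation between objects, which is an     *)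
(* axiom of X, and an equation between explicit functions on nat, checked on  *)
(* the summands (lexicographic pairs i * n + j, or m + j) of their domain.    *)

Set Implicit Arguments.
Unset Strict Implicit.
Unset Printing Implicit Defensive.

Local Open Scope classical_set_scope.

(** A morphism of a translation category is an arrow of [I] or [P] together with the point at its
    source; the point at its target is forced by functoriality of X. A diagram therefore commutes as
    soon as its ends match and the underlying injections agree ([tr_Mor_eq], [compositeI],
    [commsqI]). The matching of ends is what the axioms of X say: [mu_natural], [muC], [muA] for the
    sum, [pi_natural], [piC], [piA] for the product, [piDl] and [piDr] for the distributivity maps.
    What remains is that [I] is permutative under the sum and that [P] is bipermutative. This is
    block arithmetic: left distributivity fixes every index and right distributivity interleaves
    blocks; the longest diagram is [bitr_dl_dr_add].

    For the topology, the spaces of objects and morphisms are coproducts of spaces X n, and on each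
    piece the structure maps are built from the continuous [mu], [rpi] and [Imap] with a fixed
    arrow. Composition requires moreover that the composite arrow be locally constant
    ([tr_tcomp_continuous]). A morphism T changes points and leaves arrows alone, so it induces a
    strict functor, compatibly with identities and composition. *)

(** * Continuity on products of coproducts *)

Definition nbhs_map (S T : topologicalType) (e : S -> T) :=
  forall x A, nbhs x A -> nbhs (e x) (e @` A).

Lemma nbhs_map_prod (S T S' T' : topologicalType) (e : S -> T) (e' : S' -> T') :
  nbhs_map e -> nbhs_map e' -> nbhs_map (fun p => (e p.1, e' p.2)).
Proof.
move=> eN eN' [x x'] A [[B B'] /= [Bx Bx'] BA].
exists (e @` B, e' @` B'); first by split; [exact: eN|exact: eN'].
by case=> y y' [] /= [z Bz <-] [z' Bz' <-]; exists (z, z') => //; exact: BA.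
Qed.

(** [nbhs_map] means that [e] is open: the preimage of V under [f] contains the [e]-image of a
    neighbourhood of [x], hence is a neighbourhood of [e x]. *)
Lemma nbhs_map_continuous (S T U : topologicalType) (e : S -> T) (f : T -> U)
  (x : S) : nbhs_map e -> continuous (f \o e) -> {for e x, continuous f}.
Proof.
move=> eN fe V /= /fe /= /eN; apply: filterS => _ [y Vy <-] //.
Qed.

(** The products X i * Y j map openly to the product of the coproducts and cover it, so continuity
    can be tested on them. *)
Lemma sigT_continuous2 (I J : choiceType) (X : I -> topologicalType)
    (Y : J -> topologicalType) (U : topologicalType)
    (f : {i & X i} * {j & Y j} -> U) :
  (forall i j, continuous (fun p : X i * Y j =>
     f (existT _ i p.1, existT _ j p.2))) -> continuous f.
Proof.
move=> fC [[i x] [j y]].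
apply: (nbhs_map_continuous
  (e := fun p : X i * Y j => (existT X i p.1, existT Y j p.2)) (x := (x, y))).
  by apply: nbhs_map_prod => ? ?; exact: existT_nbhs.
exact: fC.
Qed.

Lemma sigT_continuous3 (I J K : choiceType) (X : I -> topologicalType)
    (Y : J -> topologicalType) (Z : K -> topologicalType) (U : topologicalType)
    (f : {i & X i} * {j & Y j} * {k & Z k} -> U) :
  (forall i j k, continuous (fun p : X i * Y j * Z k =>
     f (existT _ i p.1.1, existT _ j p.1.2, existT _ k p.2))) -> continuous f.
Proof.
move=> fC [[[i x] [j y]] [k z]].
apply: (nbhs_map_continuous (e := fun p : X i * Y j * Z k =>
  (existT X i p.1.1, existT Y j p.1.2, existT Z k p.2)) (x := (x, y, z))).
  apply: (nbhs_map_prod (e := fun p : X i * Y j =>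
    (existT X i p.1, existT Y j p.2))) => [|? ?]; last exact: existT_nbhs.
  by apply: nbhs_map_prod => ? ?; exact: existT_nbhs.
exact: fC.
Qed.

Lemma continuous_pair (T U V W : topologicalType) (f : T -> U) (g : T -> V)
    (h : U * V -> W) :
  continuous f -> continuous g -> continuous h ->
  continuous (fun t => h (f t, g t)).
Proof.
move=> fC gC hC t; apply: (continuous_comp (f := fun t => (f t, g t))).
  by apply: cvg_pair; [exact: fC|exact: gC].
exact: hC.
Qed.

Lemma set_type_nbhs (T : topologicalType) (A : set T) (p : A) (W : set T)
    (V : set A) :
  nbhs (set_val p) W -> set_val @^-1` W `<=` V -> nbhs p V.
Proof. by move=> /(@initial_continuous _ _ set_val p) pW /filterS; exact. Qed.

Lemma continuous_existT (I : choiceType) (X : I -> topologicalType)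
    (T : topologicalType) (i : I) (g : T -> X i) :
  continuous g -> continuous (fun t => existT X i (g t)).
Proof.
by move=> gC t; apply: continuous_comp; [exact: gC|exact: existT_continuous].
Qed.

(** * Arrows of I as functions on nat *)

(* An arrow of I as a function on nat, with junk value 0 outside its domain:  *)
(* equations between arrows whose (co)domains are only provably equal become  *)
(* equations between natural numbers.                                         *)
Definition Inat m n (a : Ihom m n) (i : nat) : nat :=
  if insub i is Some j then a j else 0.

Lemma InatE m n (a : Ihom m n) (i : 'I_m) : Inat a i = a i.
Proof. by rewrite /Inat valK. Qed.

Lemma Inat_lt m n (a : Ihom m n) i : i < m -> Inat a i < n.
Proof. by move=> im; rewrite -[i]/(val (Ordinal im)) InatE. Qed.

Lemma Inat_id n i : i < n -> Inat (Iid n) i = i.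
Proof. by move=> im; rewrite -[i]/(val (Ordinal im)) InatE ImkE. Qed.

Lemma Inat_cast m n (e : m = n) i : i < m -> Inat (Icast e) i = i.
Proof. by move=> im; rewrite -[i]/(val (Ordinal im)) InatE ImkE. Qed.

Lemma Inat_comp m n k (b : Ihom n k) (a : Ihom m n) i :
  i < m -> Inat (Icomp b a) i = Inat b (Inat a i).
Proof. by move=> im; rewrite -[i]/(val (Ordinal im)) !InatE ImkE. Qed.

Lemma Inat_sum1 m n m' n' (a : Ihom m m') (b : Ihom n n') i :
  i < m -> Inat (Isum a b) i = Inat a i.
Proof.
move=> im; rewrite -[i]/(val (lshift n (Ordinal im))) InatE ImkE /sum_fun.
by rewrite -[lshift _ _]/(unsplit (inl _)) unsplitK /= -InatE.
Qed.

Lemma Inat_sum2 m n m' n' (a : Ihom m m') (b : Ihom n n') j :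
  j < n -> Inat (Isum a b) (m + j) = m' + Inat b j.
Proof.
move=> jn; rewrite -[m + j]/(val (rshift m (Ordinal jn))) InatE ImkE /sum_fun.
by rewrite -[rshift _ _]/(unsplit (inr _)) unsplitK /= -InatE.
Qed.

(** In composites the index has the form [m + j] only through a provable equality of domains, which
    becomes a side condition here. *)
Lemma Inat_sum2_eq m n m' n' (a : Ihom m m') (b : Ihom n n') i j :
  i = m + j -> j < n -> Inat (Isum a b) i = m' + Inat b j.
Proof. by move=> ->; exact: Inat_sum2. Qed.

Lemma Inat_prod m n m' n' (a : Ihom m m') (b : Ihom n n') i j :
  i < m -> j < n -> Inat (Iprod a b) (i * n + j) = Inat a i * n' + Inat b j.
Proof.
move=> im jn; rewrite -[i * n + j]/(val (lex (Ordinal im) (Ordinal jn))) InatE.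
by rewrite ImkE /prod_fun lex1K lex2K /= -!InatE.
Qed.

Lemma Inat_prod_eq m n m' n' (a : Ihom m m') (b : Ihom n n') k i j :
  k = i * n + j -> i < m -> j < n ->
  Inat (Iprod a b) k = Inat a i * n' + Inat b j.
Proof. by move=> ->; exact: Inat_prod. Qed.

Lemma Inat_tau1 m n i : i < m -> Inat (Itau m n) i = n + i.
Proof.
move=> im; rewrite -[i]/(val (lshift n (Ordinal im))) InatE ImkE /tau_fun.
by rewrite -[lshift _ _]/(unsplit (inl _)) unsplitK.
Qed.

Lemma Inat_tau2 m n j : j < n -> Inat (Itau m n) (m + j) = j.
Proof.
move=> jn; rewrite -[m + j]/(val (rshift m (Ordinal jn))) InatE ImkE /tau_fun.
by rewrite -[rshift _ _]/(unsplit (inr _)) unsplitK.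
Qed.

Lemma Inat_taux m n i j :
  i < m -> j < n -> Inat (Itaux m n) (i * n + j) = j * m + i.
Proof.
move=> im jn; rewrite -[i * n + j]/(val (lex (Ordinal im) (Ordinal jn))) InatE.
by rewrite ImkE /taux_fun lex1K lex2K.
Qed.

Lemma Inat_deltal m n k i : i < m * k + n * k -> Inat (Ideltal m n k) i = i.
Proof. exact: Inat_cast. Qed.

Lemma Inat_deltar1 m n k i j :
  i < m -> j < n -> Inat (Ideltar m n k) (i * n + j) = i * (n + k) + j.
Proof.
move=> im jn; rewrite -[i * n + j]/(val (lshift (m * k)
  (lex (Ordinal im) (Ordinal jn)))) InatE ImkE /deltar_fun.
by rewrite -[lshift _ _]/(unsplit (inl _)) unsplitK /= divnMDl ?modnMDl
  ?(divn_small jn) ?(modn_small jn) ?addn0 //; case: n jn.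
Qed.

Lemma Inat_deltar2 m n k i j : i < m -> j < k ->
  Inat (Ideltar m n k) (m * n + (i * k + j)) = i * (n + k) + (n + j).
Proof.
move=> im jk; rewrite -[m * n + (i * k + j)]/(val (rshift (m * n)
  (lex (Ordinal im) (Ordinal jk)))) InatE ImkE /deltar_fun.
by rewrite -[rshift _ _]/(unsplit (inr _)) unsplitK /= divnMDl ?modnMDl
  ?(divn_small jk) ?(modn_small jk) ?addn0 //; case: k jk.
Qed.

Lemma lex_lt m n i j : i < m -> j < n -> i * n + j < m * n.
Proof. by move=> im jn; exact: (lex_subproof (Ordinal im) (Ordinal jn)). Qed.

Variant ltnD_spec m n : nat -> Prop :=
  | LtnD1 i of i < m : ltnD_spec m n i
  | LtnD2 j of j < n : ltnD_spec m n (m + j).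

Lemma ltnDP m n i : i < m + n -> ltnD_spec m n i.
Proof.
case: (ltnP i m) => [im _|mi imn]; first by left.
by rewrite -(subnKC mi); constructor; rewrite ltn_subLR.
Qed.

Variant ltnM_spec m n : nat -> Prop :=
  | LtnM i j of i < m & j < n : ltnM_spec m n (i * n + j).

Lemma ltnMP m n i : i < m * n -> ltnM_spec m n i.
Proof.
move=> imn; rewrite -[i]/(val (Ordinal imn)) -(lexK (Ordinal imn)).
by constructor.
Qed.

(** The product is strictly associative because the lexicographic position of a triple does not
    depend on the bracketing. *)
Lemma lexA n k i j l : (i * n + j) * k + l = i * (n * k) + (j * k + l).
Proof. by rewrite mulnDl mulnA addnA. Qed.

(** This is why left distributivity can be the identity: the pair (i, j) of the second block already
    sits where (m + i, j) does. *)
Lemma lexD m n i j : m * n + (i * n + j) = (m + i) * n + j.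
Proof. by rewrite mulnDl addnA. Qed.

Lemma Inat_sum_id m n m' n' (a : Ihom m m') (b : Ihom n n') i : m = m' ->
  {in gtn m, forall j, Inat a j = j} -> {in gtn n, forall j, Inat b j = j} ->
  i < m + n -> Inat (Isum a b) i = i.
Proof.
move=> mm' aid bid /ltnDP[{}i im|j jn]; first by rewrite Inat_sum1 // aid.
by rewrite Inat_sum2 // bid // mm'.
Qed.

(** * Translation categories *)

Lemma composite_ex (C : tcat_data) (g f : Mor C) :
  src g = tgt f -> exists h, composite g f h.
Proof.
move=> gf; have gfin : (g, f) \in composable C by exact: mem_set.
by exists (tcomp (exist _ (g, f) gfin)); exists gfin.
Qed.

(** An equality in the total space is eliminated through a predicate on both components, which
    avoids explicit transport along equalities of numbers. *)
Lemma el_eq_ind (X : Ispace) m n (x : X m) (y : X n)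
    (P : forall n, X n -> Prop) : el X x = el X y -> P m x -> P n y.
Proof.
by move=> E; rewrite -[P n y]/(P (tag (el X y)) (tagged (el X y))) -E.
Qed.

Section translation.
Variables (C : subI) (X : Ispace).
Implicit Types f g h : tr_Mor C X.

Lemma trm_eq m n m' n' (a : Ihom m n) (aC : inC C a) (x : X m)
    (a' : Ihom m' n') (aC' : inC C a') (x' : X m') :
  el X x = el X x' -> n = n' -> (forall i, i < m -> Inat a i = Inat a' i) ->
  trm aC x = trm aC' x'.
Proof.
move=> E nn'; case: n' / nn' a' aC' => a' aC' Ea.
(* The arrow out of [k] is quantified inside [P], so that replacing [x] by [x'] moves the domain of
   the arrow along with it. *)
pose P k (z : X k) := forall (b : Ihom k n) (bC : inC C b),
  (forall i, i < m -> Inat a i = Inat b i) -> trm aC x = trm bC z.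
apply: (el_eq_ind (P := P) E) Ea => {}a' {}aC' Ea.
have e : a = a'.
  apply: val_inj; apply/ffunP => i; apply: val_inj.
  by rewrite -[RHS]/(nat_of_ord (a' i)) -[LHS]/(nat_of_ord (a i)) -!InatE Ea.
by case: a' / e aC' {Ea} => aC'; rewrite (bool_irrelevance aC aC').
Qed.

Lemma tr_Mor_eq f g : tr_src f = tr_src g -> cod (tag f) = cod (tag g) ->
  (forall i, i < dom (tag f) ->
     Inat (arrI (tag f)) i = Inat (arrI (tag g)) i) -> f = g.
Proof.
by case: f g => [[m n a aC] x] [[m' n' a' aC'] x']; exact: trm_eq.
Qed.

Lemma compositeI (g f h : Mor (tr_cat C X)) :
  src g = tgt f -> src h = src f -> cod (tag h) = cod (tag g) ->
  (forall i, i < dom (tag f) -> Inat (arrI (tag h)) i =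
     Inat (arrI (tag g)) (Inat (arrI (tag f)) i)) -> composite g f h.
Proof.
move=> gf hf chg Eh.
have gfin : (g, f) \in composable (tr_cat C X) by exact: mem_set.
exists gfin; apply: tr_Mor_eq => //= i idom.
by rewrite !Inat_comp ?Inat_cast ?Inat_lt // Eh.
Qed.

Lemma compositeE (g f h : Mor (tr_cat C X)) : composite g f h ->
  [/\ src g = tgt f, src h = src f, cod (tag h) = cod (tag g) &
  (forall i, i < dom (tag f) -> Inat (arrI (tag h)) i =
     Inat (arrI (tag g)) (Inat (arrI (tag f)) i))].
Proof.
move=> [gf <-]; split => //=; first exact: set_mem gf.
by move=> i idom; rewrite !Inat_comp ?Inat_cast ?Inat_lt.
Qed.

(** The composite of [g] and [f] serves as witness. At the far end only codomains in [I] are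
    compared, since the point there is forced by source and arrow. *)
Lemma commsqI (g f g' f' : Mor (tr_cat C X)) :
  src g = tgt f -> src g' = tgt f' -> src f = src f' ->
  cod (tag g) = cod (tag g') ->
  (forall i, i < dom (tag f) ->
     Inat (arrI (tag g)) (Inat (arrI (tag f)) i) =
     Inat (arrI (tag g')) (Inat (arrI (tag f')) i)) -> commsq g f g' f'.
Proof.
move=> gf gf' ff' cg Eg.
have gfin : (g, f) \in composable (tr_cat C X) by exact: mem_set.
have : composite g f (tcomp (exist _ (g, f) gfin)) by exists gfin.
set h := tcomp _ => gfh; exists h; split => //.
case/compositeE: gfh => _ hf hg Eh; apply: compositeI => // i idom.
have dff' : dom (tag f') = dom (tag f) by case: ff'.
by rewrite Eh -?Eg // -dff'.
Qed.

End translation.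

(** * Axioms of a topological category *)

Section topcat.
Variables (C : subI) (X : Ispace).

Lemma Imap_cast m n (e : m = n) (x : X m) (y : X n) :
  el X x = el X y -> Imap X (Icast e) x = y.
Proof.
move=> E; pose P k (z : X k) := forall e : m = k, Imap X (Icast e) x = z.
apply: (el_eq_ind (P := P) E) e => e; rewrite -[RHS]Imap_id.
congr (Imap X _ x); apply: val_inj; apply/ffunP => i.
by rewrite !ffunE; exact: val_inj.
Qed.

Lemma trm_continuous m n (a : Ihom m n) (aC : inC C a) (T : topologicalType)
  (g : T -> X m) : continuous g -> continuous (fun t => trm aC (g t)).
Proof.
by move=> gC t; apply: continuous_comp; [exact: gC|exact: existT_continuous].
Qed.

(* The arrow of a composite depends only on the arrows of the factors, so it  *)
(* is locally constant on the space of composable pairs.                      *)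
Lemma tr_tcomp_continuous : continuous (@tcomp (tr_cat C X)).
Proof.
move=> p U pU; case: p pU => -[[b y] [a x]] gf pU.
(* The composite depends neither on [y'] nor on the proof of composability, so [V] can quantify over
   both. *)
pose V := [set x' | forall (y' : X (dom b)) gf',
  U (tr_comp (exist _ (existT _ b y', existT _ a x') gf'))].
have xV : nbhs x V.
  have e : cod a = dom b by have /(congr1 (@tag _ _)) := set_mem gf.
  have : nbhs x [set z | U (trm (inC_comp (arrP b)
      (inC_comp (Ibij_inC C (IbijE (Icast e) e)) (arrP a))) z)].
    pose p := exist (fun p => p \in composable (tr_cat C X)) _ gf.
    by rewrite (eq_irrelevance e (tr_comp_cod p)); exact: pU.
  apply: filterS => x' Ux' y' gf'.
  congr U: Ux'; apply: tr_Mor_eq => //.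
  by move=> i idom; rewrite /= !Inat_comp ?Inat_cast ?Inat_lt.
(* The whole sheet over [b], times the part [V] of the sheet over [a]. *)
pose W := range (existT (fun a : arrow C => X (dom a)) b) `*`
   (existT (fun a : arrow C => X (dom a)) a @` V).
apply: (@set_type_nbhs _ _ _ W).
  exists (range (existT (fun a : arrow C => X (dom a)) b),
    existT (fun a : arrow C => X (dom a)) a @` V) => //=.
  by split; apply: existT_nbhs => //; exact: filterT.
move=> [[g f] gf'] [/= [y' _ ey] [x' Vx' ex]].
by move: gf'; rewrite -ey -ex => gf'; exact: Vx'.
Qed.

(** Functoriality of X splits the composite arrow, and [Imap_cast] absorbs the identification of the
    target of [f] with the source of [g]. *)
Lemma tr_tgt_comp (g f h : Mor (tr_cat C X)) :
  composite g f h -> tgt h = tgt g.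
Proof.
move=> [gf <-].
rewrite /= /tr_tgt /= !Imap_comp (Imap_cast _ (y := tagged g)) //.
exact: (esym (set_mem gf : tr_src g = tr_tgt f)).
Qed.

Lemma tr_is_topcat : is_topcat (tr_cat C X).
Proof.
split.
- by case=> a x; apply: existT_continuous.
- apply: (@sigT_continuous _ _ _
    (fun (a : arrow C) (x : X (dom a)) => el X (Imap X (arrI a) x))).
  move=> a x; apply: continuous_comp; first exact: Imap_continuous.
  exact: existT_continuous.
- apply: (@sigT_continuous _ _ _
    (fun n (x : X n) => trm (inC_id C n) x)).
  by move=> n x; apply: existT_continuous.
- exact: tr_tcomp_continuous.
- by case.
- by case=> n x; rewrite /= /tr_tgt /= Imap_id.
- by move=> g f h /compositeE[].
- exact: tr_tgt_comp.
- move=> f; apply: compositeI => //= i idom.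
  by rewrite Inat_id // Inat_lt.
- move=> f; apply: compositeI => //= [|i idom].
    by rewrite /tr_tgt /= Imap_id.
  by rewrite Inat_id.
- move=> f g h gf hg /[dup] /tr_tgt_comp Tgf /compositeE[gf' Sgf Cgf Egf].
  move=> /compositeE[hg' Shg Chg Ehg].
  apply: commsqI.
  + exact: etrans hg' (esym Tgf).
  + exact: etrans Shg gf'.
  + exact: Sgf.
  + exact: esym Chg.
  + have domgf : dom (tag gf) = dom (tag f) := congr1 (@tag _ _) Sgf.
    have codf : dom (tag g) = cod (tag f) := congr1 (@tag _ _) gf'.
    move=> i im; have idom : i < dom (tag f) by rewrite -domgf.
    by rewrite Egf // Ehg // codf Inat_lt.
Qed.

End topcat.

(** * Permutative structures *)

Section add.
Variables (C : subI) (X : cIMonoid).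
Local Notation Cat := (tr_cat C X).
Local Notation M := (tr_add C X).

Lemma tr_add_op0A (a b c : Ob Cat) : op0 M (op0 M a b) c = op0 M a (op0 M b c).
Proof. exact: muA. Qed.

Lemma tr_add_op1_src (f g : Mor Cat) :
  src (op1 M f g) = op0 M (src f) (src g).
Proof. by []. Qed.

Lemma tr_add_op1_tgt (f g : Mor Cat) :
  tgt (op1 M f g) = op0 M (tgt f) (tgt g).
Proof. by rewrite /= /tr_tgt /= mu_natural. Qed.

Lemma tr_add_sym_tgt (a b : Ob Cat) : tgt (sym M a b) = op0 M b a.
Proof. by rewrite /= /tr_tgt /= muC. Qed.

Lemma tr_add_op0_unitl (a : Ob Cat) : op0 M (unit0 M) a = a.
Proof. by case: a => n x; exact: mu1l. Qed.

Lemma tr_add_op0_unitr (a : Ob Cat) : op0 M a (unit0 M) = a.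
Proof. by case: a => n x; exact: mu1r. Qed.

Lemma tr_add_permutative : is_permutative M.
Proof.
split.
- apply: sigT_continuous2 => m n.
  exact: (continuous_existT (@mu_continuous X m n)).
- apply: sigT_continuous2 => a b.
  exact: (trm_continuous (aC := inC_sum (arrP a) (arrP b))
    (@mu_continuous X (dom a) (dom b))).
- apply: sigT_continuous2 => m n.
  exact: (trm_continuous (aC := inC_tau C m n) (@mu_continuous X m n)).
- exact: tr_add_op1_src.
- exact: tr_add_op1_tgt.
- move=> a b; apply: tr_Mor_eq => //= _ /ltnDP[i im|j jn].
    by rewrite Inat_sum1 // !Inat_id // ltn_addr.
  by rewrite Inat_sum2 // !Inat_id // ltn_add2l.
- move=> f f' h g g' k /compositeE[Sf Sh Ch Eh] /compositeE[Sg Sk Ck Ek].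
  have df : dom (tag f') = cod (tag f) := congr1 (@tag _ _) Sf.
  have dg : dom (tag g') = cod (tag g) := congr1 (@tag _ _) Sg.
  have dh : dom (tag h) = dom (tag f) := congr1 (@tag _ _) Sh.
  have dk : dom (tag k) = dom (tag g) := congr1 (@tag _ _) Sk.
  apply: compositeI.
  + by rewrite tr_add_op1_tgt -Sf -Sg.
  + by rewrite !tr_add_op1_src Sh Sk.
  + by rewrite /= Ch Ck.
  + move=> /= _ /ltnDP[i im|j jn].
      by rewrite !Inat_sum1 ?dh ?df ?Eh ?Inat_lt.
    rewrite (Inat_sum2 _ _ jn) (Inat_sum2_eq _ _ (j := j)) ?dh ?dk // Ek //.
    (* The shift by the codomain of [f] is read as a shift by the domain of [f']; the two agree by
       [df]. *)
    by rewrite (Inat_sum2_eq _ _ (j := Inat (arrI (tag g)) j)) ?df ?dg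
      ?Inat_lt // Ch.
- exact: tr_add_op0A.
- move=> f g h; apply: tr_Mor_eq.
  + exact: (tr_add_op0A (src f) (src g) (src h)).
  + exact/esym/addnA.
 
  + move=> /= _ /ltnDP[_ /ltnDP[i im|j jn]|k kn].
    * by rewrite !Inat_sum1 // ltn_addr.
    * by rewrite Inat_sum1 ?ltn_add2l // !Inat_sum2 // ?Inat_sum1 // ltn_addr.
    * rewrite Inat_sum2 // [RHS](Inat_sum2_eq _ _ (esym (addnA _ _ k))).
        by rewrite Inat_sum2 // addnA.
      by rewrite ltn_add2l.
- exact: tr_add_op0_unitl.
- exact: tr_add_op0_unitr.
- move=> f; apply: tr_Mor_eq => //=; first exact: tr_add_op0_unitl (src f).
  (* The first summand is empty, so [i] is the index [0 + i] of the second one. *)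
  by move=> i im; rewrite -{1}[i]add0n Inat_sum2.
- move=> f; apply: tr_Mor_eq; [exact: tr_add_op0_unitr (src f)|exact: addn0|].
  by move=> /= _ /ltnDP[i im|//]; rewrite Inat_sum1.
- by [].
- exact: tr_add_sym_tgt.
- move=> f g; apply: commsqI.
  + by rewrite tr_add_op1_tgt.
  + by rewrite tr_add_sym_tgt.
  + by [].
  + by [].
  + move=> /= _ /ltnDP[i im|j jn].
      by rewrite Inat_sum1 // !Inat_tau1 ?Inat_lt // Inat_sum2.
    by rewrite Inat_sum2 // !Inat_tau2 ?Inat_lt // Inat_sum1.
- move=> a b; apply: compositeI; rewrite ?tr_add_sym_tgt //.
  move=> /= _ /ltnDP[i im|j jn].
    by rewrite (Inat_tau1 _ im) Inat_tau2 // Inat_id // ltn_addr.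
  by rewrite (Inat_tau2 _ jn) Inat_tau1 // Inat_id // ltn_add2l.
- move=> [m x]; apply: tr_Mor_eq => //=; first exact: mu1r.
  by move=> /= _ /ltnDP[i im|//]; rewrite Inat_tau1 // Inat_id.
(* The hexagon: [c] passes [b], then [a]. Each of the three blocks is followed separately, [addnA]
   exposing the block that the next map sees. *)
- move=> a b c; apply: compositeI.
  + rewrite tr_add_op1_tgt tr_add_sym_tgt (tgt_idm (tr_is_topcat C X)).
    exact: tr_add_op0A.
  + exact: tr_add_op0A.
  + exact: addnA.
  + move=> /= _ /ltnDP[i im|_ /ltnDP[i im|j jn]].
    * rewrite Inat_tau1 ?ltn_addr // (Inat_sum1 (Iid _) _ im) Inat_id //.
      by rewrite Inat_sum1 ?ltn_addr // Inat_tau1.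
    * rewrite (Inat_sum2 (Iid _)) ?ltn_addr // (Inat_tau1 _ im).
      rewrite Inat_tau1 ?ltn_add2l //.
      by rewrite [X in Inat (Isum _ _) X]addnA Inat_sum2 // Inat_id // addnA.
    * rewrite (Inat_sum2 (Iid _)) ?ltn_add2l // (Inat_tau2 _ jn).
      rewrite [X in Inat (Itau (_ + _) _) X]addnA Inat_tau2 //.
      by rewrite Inat_sum1 ?ltn_add2l // Inat_tau2.
Qed.

End add.

(** * The product over bijections *)

Section mul.
Variables (z : bool) (X : cIRig z).
Local Notation Cat := (tr_cat CP X).
Local Notation M := (tr_mul X).

Lemma tr_mul_op0A (a b c : Ob Cat) : op0 M (op0 M a b) c = op0 M a (op0 M b c).
Proof. exact: piA. Qed.

Lemma tr_mul_op1_src (f g : Mor Cat) :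
  src (op1 M f g) = op0 M (src f) (src g).
Proof. by []. Qed.

(** [pi_natural] holds along bijections, and [arrP] supplies these because the arrows are taken over
    [CP]. *)
Lemma tr_mul_op1_tgt (f g : Mor Cat) :
  tgt (op1 M f g) = op0 M (tgt f) (tgt g).
Proof.
rewrite /= /tr_tgt /= pi_natural //.
- exact: (arrP (tag f)).
- exact: (arrP (tag g)).
Qed.

Lemma tr_mul_sym_tgt (a b : Ob Cat) : tgt (sym M a b) = op0 M b a.
Proof. by rewrite /= /tr_tgt /= piC. Qed.

Lemma tr_mul_op0_unitl (a : Ob Cat) : op0 M (unit0 M) a = a.
Proof. by case: a => n x; exact: pi1l. Qed.

Lemma tr_mul_op0_unitr (a : Ob Cat) : op0 M a (unit0 M) = a.
Proof. by case: a => n x; exact: pi1r. Qed.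

Lemma tr_mul_permutative : is_permutative M.
Proof.
split.
- apply: sigT_continuous2 => m n.
  exact: (continuous_existT (@pi_continuous z X m n)).
- apply: sigT_continuous2 => a b.
  exact: (trm_continuous (aC := inC_prod (arrP a) (arrP b))
    (@pi_continuous z X (dom a) (dom b))).
- apply: sigT_continuous2 => m n.
  exact: (trm_continuous (aC := inC_taux CP m n) (@pi_continuous z X m n)).
- exact: tr_mul_op1_src.
- exact: tr_mul_op1_tgt.
- move=> a b; apply: tr_Mor_eq => //= _ /ltnMP[i j im jn].
  by rewrite Inat_prod // !Inat_id // lex_lt.
- move=> f f' h g g' k /compositeE[Sf Sh Ch Eh] /compositeE[Sg Sk Ck Ek].
  have df : dom (tag f') = cod (tag f) := congr1 (@tag _ _) Sf.
  have dg : dom (tag g') = cod (tag g) := congr1 (@tag _ _) Sg.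
  have dh : dom (tag h) = dom (tag f) := congr1 (@tag _ _) Sh.
  have dk : dom (tag k) = dom (tag g) := congr1 (@tag _ _) Sk.
  apply: compositeI.
  + by rewrite tr_mul_op1_tgt -Sf -Sg.
  + by rewrite !tr_mul_op1_src Sh Sk.
  + by rewrite /= Ch Ck.
  + move=> /= _ /ltnMP[i j im jn]; rewrite (Inat_prod _ _ im jn).
    rewrite (Inat_prod_eq _ _ (i := i) (j := j)) ?dh ?dk // Eh // Ek //.
    by rewrite (Inat_prod_eq _ _ (i := Inat (arrI (tag f)) i)
      (j := Inat (arrI (tag g)) j)) ?df ?dg ?Inat_lt // Ck.
- exact: tr_mul_op0A.
- move=> f g h; apply: tr_Mor_eq.
  + exact: (tr_mul_op0A (src f) (src g) (src h)).
  + exact/esym/mulnA.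
  + move=> /= _ /ltnMP[_ k /ltnMP[i j im jn] kl].
    rewrite !Inat_prod ?lex_lt // [X in Inat (Iprod _ (Iprod _ _)) X]lexA.
    by rewrite !Inat_prod ?lex_lt // lexA.
- exact: tr_mul_op0_unitl.
- exact: tr_mul_op0_unitr.
- move=> f; apply: tr_Mor_eq => /=.
  + exact: tr_mul_op0_unitl (src f).
  + exact: mul1n.
  (* A pair in the product of 1 and n has first coordinate 0, so its position is its second
     coordinate. *)
  + by move=> _ /ltnMP[[|//] j _ jn]; rewrite Inat_prod // Inat_id.
- move=> f; apply: tr_Mor_eq => /=.
  + exact: tr_mul_op0_unitr (src f).
  + exact: muln1.
  + move=> _ /ltnMP[i [|//] im _]; rewrite Inat_prod // Inat_id //.
    by rewrite !muln1 !addn0.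
- by [].
- exact: tr_mul_sym_tgt.
- move=> f g; apply: commsqI.
  + by rewrite tr_mul_op1_tgt.
  + by rewrite tr_mul_sym_tgt.
  + by [].
  + by [].
  + move=> /= _ /ltnMP[i j im jn].
    rewrite Inat_prod // (Inat_taux im jn) Inat_taux ?Inat_lt //.
    by rewrite Inat_prod.
- move=> a b; apply: compositeI; rewrite ?tr_mul_sym_tgt //.
  move=> /= _ /ltnMP[i j im jn].
  by rewrite (Inat_taux im jn) Inat_taux // Inat_id // lex_lt.
- move=> [m x]; apply: tr_Mor_eq => /=.
  + exact: pi1r.
  + exact: mul1n.
  + move=> _ /ltnMP[i [|//] im _].
    by rewrite Inat_taux // muln1 addn0 mul0n Inat_id.
- move=> a b c; apply: compositeI.
  + rewrite tr_mul_op1_tgt tr_mul_sym_tgt (tgt_idm (tr_is_topcat CP X)).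
    exact: tr_mul_op0A.
  + exact: tr_mul_op0A.
  + exact: mulnA.
  + move=> /= _ /ltnMP[i _ im /ltnMP[j k jn kl]].
    rewrite (Inat_prod (Iid _)) ?lex_lt // Inat_id // (Inat_taux jn kl) -!lexA.
    by rewrite Inat_prod ?lex_lt // !Inat_taux ?lex_lt // Inat_id // lexA.
Qed.

End mul.

(** * Distributivity *)

Section bip.
Variables (z : bool) (X : cIRig z).
Local Notation B := (bitranslation X).
Local Notation "a ⊕ b" := (op0 (badd B) a b) (at level 50, left associativity).
Local Notation "a ⊗ b" := (op0 (bmul B) a b) (at level 40, left associativity).
Local Notation "f ⊞ g" := (op1 (badd B) f g) (at level 50, left associativity).
Local Notation "f ⊠ g" := (op1 (bmul B) f g) (at level 40, left associativity).

Let srcD (f g : Mor B) : src (f ⊞ g) = src f ⊕ src g. Proof. by []. Qed.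
Let srcM (f g : Mor B) : src (f ⊠ g) = src f ⊗ src g. Proof. by []. Qed.
Let tgtD (f g : Mor B) : tgt (f ⊞ g) = tgt f ⊕ tgt g.
Proof. exact: tr_add_op1_tgt. Qed.
Let tgtM (f g : Mor B) : tgt (f ⊠ g) = tgt f ⊗ tgt g.
Proof. exact: tr_mul_op1_tgt. Qed.
Let tgtI (a : Ob B) : tgt (idm a) = a.
Proof. exact: (tgt_idm (tr_is_topcat CP X)). Qed.
Let tgtSD (a b : Ob B) : tgt (sym (badd B) a b) = b ⊕ a.
Proof. exact: tr_add_sym_tgt. Qed.
Let tgtSM (a b : Ob B) : tgt (sym (bmul B) a b) = b ⊗ a.
Proof. exact: tr_mul_sym_tgt. Qed.
Let srcI (a : Ob B) : src (idm a) = a. Proof. by case: a. Qed.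
Let srcSD (a b : Ob B) : src (sym (badd B) a b) = a ⊕ b. Proof. by []. Qed.
Let srcSM (a b : Ob B) : src (sym (bmul B) a b) = a ⊗ b. Proof. by []. Qed.
Let opDA (a b c : Ob B) : a ⊕ b ⊕ c = a ⊕ (b ⊕ c).
Proof. exact: tr_add_op0A. Qed.
Let opMA (a b c : Ob B) : a ⊗ b ⊗ c = a ⊗ (b ⊗ c).
Proof. exact: tr_mul_op0A. Qed.
Let srcL (a b c : Ob B) : src (dl a b c) = (a ⊗ c) ⊕ (b ⊗ c).
Proof. by []. Qed.
Let srcR (a b c : Ob B) : src (dr a b c) = (a ⊗ b) ⊕ (a ⊗ c).
Proof. by []. Qed.

Lemma bitr_dl_tgt (a b c : Ob B) : tgt (dl a b c) = (a ⊕ b) ⊗ c.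
Proof. by rewrite /= /tr_tgt /= piDl. Qed.

Lemma bitr_dr_tgt (a b c : Ob B) : tgt (dr a b c) = a ⊗ (b ⊕ c).
Proof. by rewrite /= /tr_tgt /= piDr. Qed.

(** A rewriting system that computes sources and targets and associates to the right; it settles the
    object part of the coherence diagrams. *)
Let endsE := (srcD, srcM, srcI, srcSD, srcSM, srcL, srcR,
              tgtD, tgtM, tgtI, tgtSD, tgtSM, bitr_dl_tgt, bitr_dr_tgt,
              opDA, opMA).

Lemma bitr_dl_natural (f f' g : Mor B) :
  commsq (dl (tgt f) (tgt f') (tgt g)) ((f ⊠ g) ⊞ (f' ⊠ g))
         ((f ⊞ f') ⊠ g) (dl (src f) (src f') (src g)).
Proof.
apply: commsqI; [by rewrite !endsE|by rewrite !endsE|by []|by []|].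
move=> /= _ /ltnDP[_ /ltnMP[i j im jn]|_ /ltnMP[i j im jn]].
- rewrite Inat_sum1 ?lex_lt // Inat_prod // Inat_deltal; last first.
    by rewrite ltn_addr // lex_lt ?Inat_lt.
  rewrite Inat_deltal ?ltn_addr ?lex_lt // Inat_prod ?ltn_addr //.
  by rewrite Inat_sum1.
- rewrite Inat_sum2 ?lex_lt // Inat_prod // Inat_deltal; last first.
    by rewrite ltn_add2l lex_lt ?Inat_lt.
  rewrite Inat_deltal ?ltn_add2l ?lex_lt //.
  rewrite [X in Inat (Iprod _ _) X]lexD Inat_prod ?ltn_add2l //.
  by rewrite Inat_sum2 // lexD.
Qed.

Lemma bitr_dr_natural (f g g' : Mor B) :
  commsq (dr (tgt f) (tgt g) (tgt g')) ((f ⊠ g) ⊞ (f ⊠ g'))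
         (f ⊠ (g ⊞ g')) (dr (src f) (src g) (src g')).
Proof.
apply: commsqI; [by rewrite !endsE|by rewrite !endsE|by []|by []|].
move=> /= _ /ltnDP[_ /ltnMP[i j im jn]|_ /ltnMP[i j im jn]].
- rewrite Inat_sum1 ?lex_lt // Inat_prod // Inat_deltar1 ?Inat_lt //.
  by rewrite Inat_deltar1 // Inat_prod ?ltn_addr // Inat_sum1.
- rewrite Inat_sum2 ?lex_lt // Inat_prod // Inat_deltar2 ?Inat_lt //.
  by rewrite Inat_deltar2 // Inat_prod ?ltn_add2l // Inat_sum2.
Qed.

Lemma bitr_dl_unit (a a' : Ob B) :
  dl a a' (unit0 (bmul B)) = idm (a ⊕ a') :> Mor B.
Proof.
apply: tr_Mor_eq.
- rewrite -[LHS]/(a ⊗ unit0 (bmul B) ⊕ a' ⊗ unit0 (bmul B)).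
  by rewrite !tr_mul_op0_unitr.
- exact: muln1.
- move=> /= i im; rewrite Inat_deltal // Inat_id //.
  by move: im; rewrite !muln1.
Qed.

Lemma bitr_dr_unit (a a' : Ob B) :
  dr (unit0 (bmul B)) a a' = idm (a ⊕ a') :> Mor B.
Proof.
apply: tr_Mor_eq.
- rewrite -[LHS]/(unit0 (bmul B) ⊗ a ⊕ unit0 (bmul B) ⊗ a').
  by rewrite !tr_mul_op0_unitl.
- exact: mul1n.
- move=> /= _ /ltnDP[_ /ltnMP[[|//] j _ jn]|_ /ltnMP[[|//] j _ jn]].
  + by rewrite Inat_deltar1 // Inat_id // ltn_addr.
  + by rewrite Inat_deltar2 // Inat_id !mul1n !mul0n !add0n ?ltn_add2l.
Qed.

(** All four maps fix every index, so both routes do. *)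
Lemma bitr_dl_add (a a' a'' b : Ob B) :
  commsq (dl (a ⊕ a') a'' b) (dl a a' b ⊞ idm (a'' ⊗ b))
         (dl a (a' ⊕ a'') b) (idm (a ⊗ b) ⊞ dl a' a'' b).
Proof.
apply: commsqI; [by rewrite !endsE|by rewrite !endsE|by rewrite !endsE| |].
  by rewrite /= addnA.
move=> /= i im; have im' := im; rewrite -addnA in im'.
rewrite (Inat_sum_id (esym (mulnDl _ _ _)) _ _ im); last first.
- by move=> j jn; rewrite Inat_id.
- by move=> j jn; rewrite Inat_deltal.
rewrite (Inat_sum_id erefl _ _ im'); last first.
- by move=> j jn; rewrite Inat_deltal.
- by move=> j jn; rewrite Inat_id.
by rewrite !Inat_deltal ?mulnDl // addnA.
Qed.

(** Both routes send the pair (i, j) of a block to row i, with column offset 0, n or n + p according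
    to the block. *)
Lemma bitr_dr_add (a b b' b'' : Ob B) :
  commsq (dr a (b ⊕ b') b'') (dr a b b' ⊞ idm (a ⊗ b''))
         (dr a b (b' ⊕ b'')) (idm (a ⊗ b) ⊞ dr a b' b'').
Proof.
apply: commsqI; [by rewrite !endsE|by rewrite !endsE|by rewrite !endsE| |].
  by rewrite /= addnA.
move=> /=; move: (tag a) (tag b) (tag b') (tag b'') => m n p k.
move=> _ /ltnDP[_ /ltnDP[_ /ltnMP[i j im jn]|_ /ltnMP[i j im jn]]|
  _ /ltnMP[i j im jn]].
- rewrite (Inat_sum1 (Ideltar _ _ _)) ?ltn_addr ?lex_lt // Inat_deltar1 //.
  rewrite Inat_deltar1 ?ltn_addr // (Inat_sum1 (Iid _)) ?lex_lt //.
  rewrite Inat_id ?lex_lt //.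
  by rewrite Inat_deltar1 // addnA.
- rewrite (Inat_sum1 (Ideltar _ _ _)) ?ltn_add2l ?lex_lt // Inat_deltar2 //.
  rewrite Inat_deltar1 ?ltn_add2l // (Inat_sum2 (Iid _)) ?ltn_addr ?lex_lt //.
  by rewrite (Inat_deltar1 _ im jn) Inat_deltar2 ?ltn_addr // !addnA.
- rewrite (Inat_sum2 (Ideltar _ _ _)) ?lex_lt // Inat_id ?lex_lt //.
  rewrite Inat_deltar2 // -[X in Inat (Isum (Iid _) _) X]addnA.
  rewrite (Inat_sum2 (Iid _)) ?ltn_add2l ?lex_lt // Inat_deltar2 //.
  by rewrite Inat_deltar2 ?ltn_add2l // !addnA.
Qed.

Lemma bitr_dl_gadd (a a' b : Ob B) :
  commsq (sym (badd B) a a' ⊠ idm b) (dl a a' b)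
         (dl a' a b) (sym (badd B) (a ⊗ b) (a' ⊗ b)).
Proof.
apply: commsqI; [by rewrite !endsE|by rewrite !endsE|by []|by []|].
move=> /=; move: (tag a) (tag a') (tag b) => m n k.
move=> _ /ltnDP[_ /ltnMP[i j im jn]|_ /ltnMP[i j im jn]].
- rewrite (Inat_deltal (m := m)) ?ltn_addr ?lex_lt // Inat_tau1 ?lex_lt //.
  rewrite Inat_deltal ?ltn_add2l ?lex_lt // lexD Inat_prod ?ltn_addr //.
  by rewrite Inat_tau1 // Inat_id.
- rewrite (Inat_deltal (m := m)) ?ltn_add2l ?lex_lt // Inat_tau2 ?lex_lt //.
  rewrite Inat_deltal ?ltn_addr ?lex_lt // lexD Inat_prod ?ltn_add2l //.
  by rewrite Inat_tau2 // Inat_id.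
Qed.

Lemma bitr_dr_gadd (a b b' : Ob B) :
  commsq (idm a ⊠ sym (badd B) b b') (dr a b b')
         (dr a b' b) (sym (badd B) (a ⊗ b) (a ⊗ b')).
Proof.
apply: commsqI; [by rewrite !endsE|by rewrite !endsE|by []|by []|].
move=> /=; move: (tag a) (tag b) (tag b') => m n k.
move=> _ /ltnDP[_ /ltnMP[i j im jn]|_ /ltnMP[i j im jn]].
- rewrite Inat_deltar1 // Inat_tau1 ?lex_lt // Inat_deltar2 //.
  by rewrite Inat_prod ?ltn_addr // Inat_id // Inat_tau1.
- rewrite Inat_deltar2 // Inat_tau2 ?lex_lt // Inat_deltar1 //.
  by rewrite Inat_prod ?ltn_add2l // Inat_id // Inat_tau2.
Qed.

Lemma bitr_dl_mul (a a' b c : Ob B) :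
  composite (dl a a' b ⊠ idm c) (dl (a ⊗ b) (a' ⊗ b) c) (dl a a' (b ⊗ c)).
Proof.
apply: compositeI; [by rewrite !endsE|by rewrite !endsE| |].
  by rewrite /= mulnA.
move=> /=; move: (tag a) (tag a') (tag b) (tag c) => m n k l i im.
rewrite Inat_deltal; last by move: im; rewrite !mulnA.
rewrite Inat_deltal //; move: im; rewrite -mulnDl => /ltnMP[p q pm ql].
by rewrite Inat_prod // Inat_deltal // Inat_id.
Qed.

Lemma bitr_dr_mul (a b c c' : Ob B) :
  composite (idm a ⊠ dr b c c') (dr a (b ⊗ c) (b ⊗ c')) (dr (a ⊗ b) c c').
Proof.
apply: compositeI; [by rewrite !endsE|by rewrite !endsE| |].
  by rewrite /= mulnA.
move=> /=; move: (tag a) (tag b) (tag c) (tag c') => m n k l.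
move=> _ /ltnDP[_ /ltnMP[i _ im /ltnMP[j p jn pk]]|
  _ /ltnMP[i _ im /ltnMP[j p jn pl]]].
- rewrite -[X in Inat (Ideltar (m * n) k l) X]lexA Inat_deltar1 ?lex_lt //.
  rewrite Inat_deltar1 ?lex_lt // Inat_prod ?ltn_addr ?lex_lt //.
  by rewrite Inat_id // Inat_deltar1 // lexA.
- rewrite -[X in Inat (Ideltar (m * n) k l) (_ + X)]lexA.
  rewrite [X in Inat (Ideltar (m * n) k l) (X + _)]mulnA.
  rewrite Inat_deltar2 ?lex_lt //.
  rewrite Inat_deltar2 ?lex_lt // Inat_prod ?ltn_add2l ?lex_lt //.
  by rewrite Inat_id // Inat_deltar2 // lexA.
Qed.

(** Both routes send a triple (i, j, p) to itself or to (i, n + j, p), according to its block;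
    [lexA] and [lexD] match the two ways of writing its position. *)
Lemma bitr_dl_dr_mul (a b b' c : Ob B) :
  commsq (idm a ⊠ dl b b' c) (dr a (b ⊗ c) (b' ⊗ c))
         (dr a b b' ⊠ idm c) (dl (a ⊗ b) (a ⊗ b') c).
Proof.
apply: commsqI; [by rewrite !endsE|by rewrite !endsE|by rewrite !endsE| |].
  by rewrite /= mulnA.
move=> /=; move: (tag a) (tag b) (tag b') (tag c) => m n n' k.
move=> _ /ltnDP[_ /ltnMP[i _ im /ltnMP[j p jn pk]]|
  _ /ltnMP[i _ im /ltnMP[j p jn pk]]].
- rewrite Inat_deltar1 ?lex_lt // Inat_prod ?ltn_addr ?lex_lt // Inat_id //.
  rewrite Inat_deltal ?ltn_addr ?lex_lt // -[X in Inat (Ideltal _ _ _) X]lexA.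
  rewrite Inat_deltal ?ltn_addr ?lex_lt // Inat_prod ?ltn_addr ?lex_lt //.
  by rewrite Inat_deltar1 // Inat_id // lexA.
- rewrite Inat_deltar2 ?lex_lt // Inat_prod ?ltn_add2l ?lex_lt // Inat_id //.
  rewrite Inat_deltal ?ltn_add2l ?lex_lt //.
  rewrite -[X in Inat (Ideltal (m * n) _ _) (_ + X)]lexA.
  rewrite [X in Inat (Ideltal (m * n) _ _) (X + _)]mulnA.
  rewrite Inat_deltal ?ltn_add2l ?lex_lt //.
  rewrite [X in Inat (Iprod _ _) X]lexD Inat_prod ?ltn_add2l ?lex_lt //.
  by rewrite Inat_deltar2 // Inat_id // lexA lexD.
Qed.

(** Exchanging coordinates turns concatenation of rows into concatenation of columns, hence left
    distributivity into right distributivity. *)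
Lemma bitr_dl_dr_gmul (a a' b : Ob B) :
  commsq (sym (bmul B) (a ⊕ a') b) (dl a a' b)
         (dr b a a') (sym (bmul B) a b ⊞ sym (bmul B) a' b).
Proof.
apply: commsqI; [by rewrite !endsE|by rewrite !endsE|by []|by []|].
move=> /=; move: (tag a) (tag a') (tag b) => m n k.
move=> _ /ltnDP[_ /ltnMP[i j im jn]|_ /ltnMP[i j im jn]].
- rewrite Inat_deltal ?ltn_addr ?lex_lt // Inat_taux ?ltn_addr //.
  by rewrite Inat_sum1 ?lex_lt // Inat_taux // Inat_deltar1.
- rewrite Inat_deltal ?ltn_add2l ?lex_lt //.
  rewrite [X in Inat (Itaux _ _) X]lexD Inat_taux ?ltn_add2l //.
  by rewrite Inat_sum2 ?lex_lt // Inat_taux // Inat_deltar2.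
Qed.

(** Left distributivity fixes indices, so the claim is that swapping the two middle blocks and then
    applying right distributivity in each half is right distributivity for m + m'. This is checked
    on the four blocks. *)
Lemma bitr_dl_dr_add (a a' b b' : Ob B) : exists h,
  composite (dr a b b' ⊞ dr a' b b')
    (idm (a ⊗ b) ⊞ sym (badd B) (a' ⊗ b) (a ⊗ b') ⊞ idm (a' ⊗ b')) h /\
  commsq (dr (a ⊕ a') b b') (dl a a' b ⊞ dl a a' b')
         (dl a a' (b ⊕ b')) h.
Proof.
pose f := idm (a ⊗ b) ⊞ sym (badd B) (a' ⊗ b) (a ⊗ b') ⊞ idm (a' ⊗ b').
have [|h gfh] := @composite_ex B (dr a b b' ⊞ dr a' b b') f.
  by rewrite !endsE.
exists h; split => //; have [_ Sh Ch Eh] := compositeE gfh.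
have Th := tr_tgt_comp gfh.
apply: commsqI => //.
- by rewrite !endsE.
- by rewrite Th !endsE.
- by rewrite Sh !endsE.
move: Eh => /=; move: (arrI (tag h)) => ah.
move: (tag a) (tag a') (tag b) (tag b') ah => m m' n n' ah Eh.
move=> i lti; have lti' : i < m * n + (m' * n + m * n') + m' * n'.
  by move: lti; rewrite !addnA.
rewrite (Inat_sum_id (esym (mulnDl _ _ _)) _ _ lti); first last.
- by move=> j jn; rewrite Inat_deltal.
- by move=> j jn; rewrite Inat_deltal.
rewrite Eh // Inat_deltal; last first.
  (* The bound comes from the codomain of the middle swap, which agrees with the domain of the next
     map only up to associativity of addition. *)
  apply: Inat_lt; rewrite -[X in _ < X]/(m * n + m * n' + (m' * n + m' * n')).
  have -> : m * n + m * n' + (m' * n + m' * n') =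
      m * n + (m * n' + m' * n) + m' * n' by ring.
  exact: Inat_lt.
rewrite {Eh Sh Ch Th gfh f ah lti'}.
case/ltnDP: lti => [_ /ltnDP[_ /ltnMP[{}i j im jn]|_ /ltnMP[{}i j im jn]]|
  _ /ltnDP[_ /ltnMP[{}i j im jn]|_ /ltnMP[{}i j im jn]]].
- rewrite (Inat_sum1 (Isum _ _)) ?ltn_addr ?lex_lt //.
  rewrite (Inat_sum1 (Iid _)) ?lex_lt // Inat_id ?lex_lt //.
  rewrite Inat_sum1 ?ltn_addr ?lex_lt //.
  by rewrite !Inat_deltar1 // ltn_addr.
- rewrite (Inat_sum1 (Isum _ _)) ?ltn_add2l ?ltn_addr ?lex_lt //.
  rewrite (Inat_sum2 (Iid _)) ?ltn_addr ?lex_lt // Inat_tau1 ?lex_lt //.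
  rewrite [X in Inat (Isum _ _) X]addnA Inat_sum2 ?ltn_addr ?lex_lt //.
  rewrite (Inat_deltar1 _ im jn) [X in Inat _ X]lexD Inat_deltar1 ?ltn_add2l //.
  by rewrite lexD.
- rewrite -[X in Inat (Isum (Isum _ _) _) X]addnA.
  rewrite (Inat_sum1 (Isum _ _)) ?ltn_add2l ?lex_lt //.
  rewrite (Inat_sum2 (Iid _)) ?ltn_add2l ?lex_lt // Inat_tau2 ?lex_lt //.
  rewrite Inat_sum1 ?ltn_add2l ?lex_lt // Inat_deltar2 //.
  by rewrite -mulnDl Inat_deltar2 ?ltn_addr.
(* The index in the last block is read in two ways: as the pair (m + i, j) of the second summand for
   right distributivity, and as a position behind the first three blocks for the swap. *)
- have eL : m * n + m' * n + (m * n' + (i * n' + j)) =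
      (m + m') * n + ((m + i) * n' + j) by ring.
  have eR : m * n + m' * n + (m * n' + (i * n' + j)) =
      m * n + (m' * n + m * n') + (i * n' + j) by ring.
  rewrite [X in Inat (Ideltar (m + m') _ _) X]eL Inat_deltar2 ?ltn_add2l //.
  rewrite eR (Inat_sum2 (Isum _ _)) ?lex_lt // Inat_id ?lex_lt //.
  have -> : m * n + (m * n' + m' * n) + (i * n' + j) =
      m * n + m * n' + (m' * n + (i * n' + j)) by ring.
  by rewrite Inat_sum2 ?ltn_add2l ?lex_lt // Inat_deltar2 // lexD.
Qed.

Lemma bitr_dl_continuous :
  continuous (fun p : Ob B * Ob B * Ob B => dl p.1.1 p.1.2 p.2).
Proof.
apply: sigT_continuous3 => m n k.
apply: (trm_continuous (aC := inC_deltal CP m n k)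
  (g := fun p : X m * X n * X k => mu X (rpi X p.1.1 p.2) (rpi X p.1.2 p.2))).
apply: (continuous_pair _ _ (@mu_continuous X _ _)).
- apply: (continuous_pair _ _ (@pi_continuous z X _ _)).
    by move=> p; apply: continuous_comp; exact: cvg_fst.
  by move=> p; exact: cvg_snd.
- apply: (continuous_pair _ _ (@pi_continuous z X _ _)).
    by move=> p; apply: continuous_comp; [exact: cvg_fst|exact: cvg_snd].
  by move=> p; exact: cvg_snd.
Qed.

Lemma bitr_dr_continuous :
  continuous (fun p : Ob B * Ob B * Ob B => dr p.1.1 p.1.2 p.2).
Proof.
apply: sigT_continuous3 => m n k.
apply: (trm_continuous (aC := inC_deltar CP m n k)
  (g := fun p : X m * X n * X k => mu X (rpi X p.1.1 p.1.2) (rpi X p.1.1 p.2))).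
apply: (continuous_pair _ _ (@mu_continuous X _ _)).
- apply: (continuous_pair _ _ (@pi_continuous z X _ _)).
    by move=> p; apply: continuous_comp; exact: cvg_fst.
  by move=> p; apply: continuous_comp; [exact: cvg_fst|exact: cvg_snd].
- apply: (continuous_pair _ _ (@pi_continuous z X _ _)).
    by move=> p; apply: continuous_comp; exact: cvg_fst.
  by move=> p; exact: cvg_snd.
Qed.

(** * The zero object *)

Section null.
Hypothesis zT : z.
Local Notation zero := (unit0 (badd B)).

Let op0M (a : Ob B) : zero ⊗ a = zero.
Proof. by case: a => n x; exact: pi0l. Qed.
Let opM0 (a : Ob B) : a ⊗ zero = zero.
Proof. by case: a => n x; exact: pi0r. Qed.
Let op0D (a : Ob B) : zero ⊕ a = a.
Proof. exact: tr_add_op0_unitl. Qed.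
Let opD0 (a : Ob B) : a ⊕ zero = a.
Proof. exact: tr_add_op0_unitr. Qed.

Let zeroE := (srcD, srcM, srcI, srcSD, srcSM, srcL, srcR,
              op0M, opM0, op0D, opD0).

(** The zero object lies over 0, so the blocks that it contributes are empty; each map is then empty
    or fixes the remaining indices. The equalities of objects rest on [pi0l] and [pi0r], available
    by [zT]. *)
Lemma bitr_null : is_null B.
Proof.
have ext (f g : Mor B) : src f = src g -> cod (tag f) = cod (tag g) ->
    (forall i, i < dom (tag f) ->
     Inat (arrI (tag f)) i = Inat (arrI (tag g)) i) -> f = g.
  exact: tr_Mor_eq.
split => //.
- by move=> f; apply: ext => //; rewrite !zeroE.
- move=> f; apply: ext; rewrite ?zeroE //=; first exact: muln0.
  by move=> _ /ltnMP[//].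
- move=> a; apply: ext; rewrite ?zeroE //=.
  by move=> _ /ltnMP[//].
- move=> a b; apply: ext; rewrite ?zeroE //=.
  by move=> i im; rewrite Inat_deltal // Inat_id.
- move=> a b; apply: ext; rewrite ?zeroE //=; first by rewrite addn0.
  by move=> i im; rewrite Inat_deltal // Inat_id //; rewrite mul0n addn0 in im.
- move=> a b; apply: ext; rewrite ?zeroE //=; first by rewrite muln0.
  by move=> _ /ltnDP[_ /ltnMP[//]|_ /ltnMP[//]].
- by move=> a b; apply: ext; rewrite ?zeroE.
- move=> a b; apply: ext; rewrite ?zeroE //=.
  move=> _ /ltnDP[_ /ltnMP[//]|_ /ltnMP[i j im jn]].
  by rewrite Inat_deltar2 // muln0 Inat_id // lex_lt.
- move=> a b; apply: ext; rewrite ?zeroE //=; first by rewrite addn0.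
  move=> _ /ltnDP[_ /ltnMP[i j im jn]|_ /ltnMP[//]].
  by rewrite Inat_deltar1 // addn0 Inat_id // lex_lt.
Qed.

End null.
End bip.

(** * Functoriality *)

Lemma tr_map_id C (X : Ispace) :
  tr_map C (fun n => id : X n -> X n) = tfun_id (tr_cat C X).
Proof. by congr TFun; apply/funext; [case|case=> -[]]. Qed.

Section morphisms.
Variables (u : bool) (C : subI).

Lemma tr_map_is_tfun (X Y : cIMonoid) (T : mon_hom u X Y) :
  is_tfun (tr_map C (sval T) : tfun (tr_cat C X) (tr_cat C Y)).
Proof.
case: T => T [Tc Tn Tm Te] /=; split => //=.
- apply: (@sigT_continuous _ _ _ (fun n (x : X n) => el Y (T n x))) => n.
  exact: (continuous_existT (Tc n)).
- apply: (@sigT_continuous _ _ _ (fun (a : arrow C) (x : X (dom a)) =>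
    trm (arrP a) (T _ x))) => a.
  exact: (trm_continuous (aC := arrP a) (Tc (dom a))).
- by move=> f; rewrite /tr_tgt /= -Tn.
- move=> g f h /compositeE[Sg Sh Ch Eh]; apply: compositeI => //=.
  (* T commutes with [Imap], and applying [f0] to an equality in the total space carries T across it
     even though the indices are different expressions. *)
  + move: Sg; rewrite /tr_src /tr_tgt /= -Tn.
    by move=> /(congr1 (f0 (tr_map C T : tfun (tr_cat C X) (tr_cat C Y)))).
  + by move: Sh => /(congr1 (f0 (tr_map C T : tfun (tr_cat C X) (tr_cat C Y)))).
Qed.

Lemma tr_map_add_strict (X Y : cIMonoid) (T : mon_hom u X Y) :
  is_strict u (tr_add C X) (tr_add C Y) (tr_map C (sval T)).
Proof.
case: T => T [Tc Tn Tm Te] /=; split => /=.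
- by move=> a b; rewrite /el Tm.
- by move=> f g; rewrite /trm /= Tm.
- by move=> a b; rewrite /trm /= Tm.
- by move=> uT; rewrite /el Te.
Qed.

End morphisms.

Lemma tr_map_is_bip_map u z (X Y : cIRig z) (T : rig_hom u X Y) :
  @is_bip_map u (bitranslation X) (bitranslation Y) (tr_map CP (sval T)).
Proof.
case: T => T [Tm Tp T1];
split => /=.
- exact: (tr_map_is_tfun CP (exist _ _ Tm : mon_hom u X Y)).
- exact: (tr_map_add_strict CP (exist _ _ Tm : mon_hom u X Y)).
- split => /=.
  + by move=> a b; rewrite /el Tp.
  + by move=> f g; rewrite /trm /= Tp.
  + by move=> a b; rewrite /trm /= Tp.
  + by move=> uT; rewrite /el T1.
- by move=> a a' b; rewrite /trm /= (mm_mu Tm) !Tp.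
- by move=> a a' b; rewrite /trm /= (mm_mu Tm) !Tp.
Qed.

Lemma bitr_is_bipermcat (z : bool) (X : cIRig z) :
  is_bipermcat (bitranslation X) z.
Proof.
split.
- exact: tr_is_topcat.
- exact: tr_add_permutative.
- exact: tr_mul_permutative.
- exact: bitr_dl_continuous.
- exact: bitr_dr_continuous.
- by [].
- exact: bitr_dl_tgt.
- by [].
- exact: bitr_dr_tgt.
- exact: bitr_dl_natural.
- exact: bitr_dr_natural.
- exact: bitr_dl_unit.
- exact: bitr_dr_unit.
- exact: bitr_dl_add.
- exact: bitr_dr_add.
- exact: bitr_dl_gadd.
- exact: bitr_dr_gadd.
- exact: bitr_dl_mul.
- exact: bitr_dr_mul.
- exact: bitr_dl_dr_mul.
- exact: bitr_dl_dr_add.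
- exact: bitr_dl_dr_gmul.
- exact: bitr_null.
Qed.

Theorem proposition2p1 (u : bool) :
  (forall C : subI,
     exists (H : forall X : cIMonoid, is_permcat (translation C X))
            (HT : forall (X Y : cIMonoid) (T : mon_hom u X Y),
               @is_perm_map u (translation C X) (translation C Y)
                 (tr_map C (proj1_sig T))),
       @functor_laws (cIMonoidCat u) (PermCat u)
         (fun X => exist _ (translation C X) (H X))
         (fun X Y T => exist _ (tr_map C (proj1_sig T)) (HT X Y T)))
  /\
  (forall z : bool,
     exists (H : forall X : cIRig z, is_bipermcat (bitranslation X) z)
            (HT : forall (X Y : cIRig z) (T : rig_hom u X Y),
               @is_bip_map u (bitranslation X) (bitranslation Y)
                 (tr_map CP (proj1_sig T))),
       @functor_laws (cIRigCat u z) (BipermCat u z)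
         (fun X => exist _ (bitranslation X) (H X))
         (fun X Y T => exist _ (tr_map CP (proj1_sig T)) (HT X Y T))).
Proof.
split=> [C|z].
- exists (fun X : cIMonoid => conj (tr_is_topcat C X) (tr_add_permutative C X)).
  exists (fun X Y T => conj (tr_map_is_tfun C T) (tr_map_add_strict C T)).
  (* Composition is respected by computation; for identities the record [arrow] has to be taken
     apart, as [tr_map_id] does. *)
  split=> [X|X Y Z S T]; apply: eq_exist => //=.
  exact: tr_map_id.
- exists (@bitr_is_bipermcat z), (@tr_map_is_bip_map u z).
  split=> [X|X Y Z S T]; apply: eq_exist => //=.
  exact: tr_map_id.
Qed.
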